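(* Suppose the weighted composition operators $C_{\phi_1,\omega_1}$ and $C_{\phi_2,\omega_2}$ in $L^2(\mu)$ are densely defined, and fix $\lambda\in(0,1)$. Write $H=h_{\phi_1,\omega_1}+h_{\phi_2,\omega_2}$. Then the following conditions are equivalent: (i) the pair $\mathcal{M}_\lambda(\mathbf{C}_{\phi,\omega})=(C_{\phi_1,\omega_\lambda^1},C_{\phi_2,\omega_\lambda^2})$ is densely defined; (ii) $C_{\phi_i,\omega_\lambda^i}$ is densely defined for $i=1,2$; (iii) $E_{\phi_i,\omega_i}(H)\circ\phi_i^{-1}<\infty$ a.e. $[\mu]$ for $i=1,2$; (iv) $E_{\phi_i,\omega_i}(h_{\phi_j,\omega_j})\circ\phi_i^{-1}<\infty$ a.e. $[\mu]$ for $i,j=1,2$; (v) $E_{\phi_i,\omega_i}(h_{\phi_j,\omega_j})<\infty$ a.e. $[\mu]$ on $\{\omega_i\neq0\}$ for $i,j=1,2$; (vi) $E_{\phi_i,\omega_i}(H)<\infty$ a.e. $[\mu]$ on $\{\omega_i\neq0\}$ for $i=1,2$; (vii) $E_{\phi_i,\omega_i}(h_{\phi_j,\omega_j})<\infty$ a.e. $[\mu_{\omega_i}]$ for $i,j=1,2$; (viii) $E_{\phi_i,\omega_i}(H)<\infty$ a.e. $[\mu_{\omega_i}]$ for $i=1,2$; (ix) $\mu_{\sqrt{H}\cdot\omega_i}\circ\phi_i^{-1}$ is $\sigma$-finite for $i=1,2$; (x) $\mu_{\sqrt{H}\cdot\omega_i}|_{\phi_i^{-1}(\mathscr{A})}$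 is $\sigma$-finite for $i=1,2$; (xi) $\mu_{\sqrt{h_{\phi_j,\omega_j}}\cdot\omega_i}\circ\phi_i^{-1}$ is $\sigma$-finite for $i,j=1,2$; (xii) $\mu_{\sqrt{h_{\phi_j,\omega_j}}\cdot\omega_i}|_{\phi_i^{-1}(\mathscr{A})}$ is $\sigma$-finite for $i,j=1,2$.
   Context: $(X,\mathscr{A},\mu)$ is a $\sigma$-finite measure space and $L^2(\mu)$ is the complex Hilbert space. For an $\mathscr{A}$-measurable transformation $\phi:X\to X$ and an $\mathscr{A}$-measurable $\omega:X\to\mathbb{C}$ (defined $\mu$-a.e.), put $\mu_\omega(\Delta)=\int_\Delta|\omega|^2d\mu$ for $\Delta\in\mathscr{A}$; $\phi^{-1}(\mathscr{A})=\{\phi^{-1}(\Delta):\Delta\in\mathscr{A}\}$. The weighted composition operator $C_{\phi,\omega}$ in $L^2(\mu)$ has domain $\{f\in L^2(\mu):\omega\cdot(f\circ\phi)\in L^2(\mu)\}$ and acts by $C_{\phi,\omega}f=\omega\cdot(f\circ\phi)$. It is always assumed that $\mu_\omega\circ\phi^{-1}\ll\mu$ (so $C_{\phi,\omega}$ is well-defined); this is automatic for $C_{\phi_i,\omega^i_\lambda}$ below. $h_{\phi,\omega}:X\to[0,\infty]$ is the ($\mu$-a.e. unique) measurable function with $\mu_\omega(\phi^{-1}(\Delta))=\int_\Delta h_{\phi,\omega}\,d\mu$ for all $\Delta\in\mathscr{A}$; $C_{\phi,\omega}$ is densely defined iff $h_{\phi,\omega}<\infty$ a.e. $[\mu]$.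 If $C_{\phi,\omega}$ is densely defined, then $\mu_\omega|_{\phi^{-1}(\mathscr{A})}$ is $\sigma$-finite, and for measurable $f:X\to[0,\infty]$, $E_{\phi,\omega}(f)$ is the ($\mu_\omega$-a.e. unique) $\phi^{-1}(\mathscr{A})$-measurable $[0,\infty]$-valued function with $\int_{\phi^{-1}(\Delta)}f\,d\mu_\omega=\int_{\phi^{-1}(\Delta)}E_{\phi,\omega}(f)\,d\mu_\omega$ for all $\Delta\in\mathscr{A}$. $E_{\phi,\omega}(f)\circ\phi^{-1}$ denotes the ($\mu$-a.e. unique) $\mathscr{A}$-measurable function on $X$ that vanishes $\mu$-a.e. on $\{h_{\phi,\omega}=0\}$ and satisfies $(E_{\phi,\omega}(f)\circ\phi^{-1})\circ\phi=E_{\phi,\omega}(f)$ a.e. $[\mu_\omega]$. A pair $(T_1,T_2)$ of operators in $L^2(\mu)$ has domain $\mathcal{D}(T_1)\cap\mathcal{D}(T_2)$ and is identified with the column operator $f\mapsto\binom{T_1f}{T_2f}$; it is densely defined if this domain is dense. If $C_{\phi_1,\omega_1},C_{\phi_2,\omega_2}$ are densely defined, the column operator $\mathbf{C}_{\phi,\omega}=(C_{\phi_1,\omega_1},C_{\phi_2,\omega_2})$ is densely defined and closed; let $\mathbf{C}_{\phi,\omega}=\binom{U_1}{U_2}|\mathbf{C}_{\phi,\omega}|$ be its polar decomposition. The $\lambda$-spherical mean transform is $$\mathcal{M}_\lambda(\mathbf{C}_{\phi,\omega})=\big(\lambda U_1|\mathbf{C}_{\phi,\omega}|+(1-\lambda)|\mathbf{C}_{\phi,\omega}|U_1,\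 \lambda U_2|\mathbf{C}_{\phi,\omega}|+(1-\lambda)|\mathbf{C}_{\phi,\omega}|U_2\big),$$ with natural domains of sums and products; for $\lambda\in(0,1)$ it equals $(C_{\phi_1,\omega_\lambda^1},C_{\phi_2,\omega_\lambda^2})$, where $\omega_\lambda^i=(\eta_i+\lambda(1-\eta_i))\,\omega_i$ a.e. $[\mu]$ with $\eta_i=\chi_{\{\omega_i\neq0\}}\big(\frac{H}{H\circ\phi_i}\big)^{1/2}$, $H=h_{\phi_1,\omega_1}+h_{\phi_2,\omega_2}$ (meaningful since $\mu(\{\omega_i\ne0\}\cap\{H\circ\phi_i=0\})=0$). *)

(* Defs.v *)
From mathcomp Require Import all_boot all_order all_algebra.
From mathcomp Require Import complex.
From mathcomp Require Import all_classical all_reals all_analysis.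
From mathcomp Require Import measurable_realfun.
Set Implicit Arguments.
Unset Strict Implicit.
Unset Printing Implicit Defensive.
Import Order.TTheory GRing.Theory Num.Theory.
Import numFieldNormedType.Exports.

Local Open Scope classical_set_scope.
Local Open Scope ring_scope.
Local Open Scope complex_scope.

Section ComplexFunctions.
Context d (X : measurableType d) (R : realType).
Variable mu : {measure set X -> \bar R}.

Definition sqmod (z : R[i]) : R := complex.Re z ^+ 2 + complex.Im z ^+ 2.

Definition cmeasurable (f : X -> R[i]) : Prop :=
  measurable_fun setT (fun x => complex.Re (f x)) /\
  measurable_fun setT (fun x => complex.Im (f x)).

(* the squared L^2 norm *)
Definition norm2 (f : X -> R[i]) : \bar R := (\int[mu]_x (sqmod (f x))%:E)%E.

(* Elements of L^2(mu) are represented by square-integrable functions; equality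
   in L^2(mu) is equality mu-almost everywhere. *)
Definition L2 (f : X -> R[i]) : Prop := cmeasurable f /\ (norm2 f < +oo)%E.

Definition eqL2 (f g : X -> R[i]) : Prop := {ae mu, forall x, f x = g x}.

Definition dot (f g : X -> R[i]) : R[i] :=
  Rintegral mu setT (fun x => complex.Re (f x * conjc (g x))) +i*
  Rintegral mu setT (fun x => complex.Im (f x * conjc (g x))).

Definition dense_in_L2 (D : set (X -> R[i])) : Prop :=
  forall f, L2 f -> forall e : R, 0 < e ->
    exists2 g, D g & (norm2 (fun x => f x - g x)%R < e%:E)%E.

End ComplexFunctions.

Section Operators.
Context d (X : measurableType d) (R : realType).
Variable mu : {measure set X -> \bar R}.

(* Possibly unbounded operators in L^2(mu) are given by their graphs, seen as
   relations between representatives. *)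
Definition operator : Type := (X -> R[i]) -> (X -> R[i]) -> Prop.

Definition is_operator (T : operator) : Prop :=
  [/\ forall f g, T f g -> L2 mu f /\ L2 mu g,
      forall f f' g g', T f g -> cmeasurable f' -> cmeasurable g' ->
        eqL2 mu f f' -> eqL2 mu g g' -> T f' g',
      T (fun=> 0) (fun=> 0),
      forall (a : R[i]) f f' g g', T f g -> T f' g' ->
        T (fun x => a * f x + f' x) (fun x => a * g x + g' x)
    & forall f g g', T f g -> T f g' -> eqL2 mu g g'].

Definition dom (B : Type) (T : (X -> R[i]) -> B -> Prop) : set (X -> R[i]) :=
  [set f | exists g, T f g].

Definition densely_defined (B : Type) (T : (X -> R[i]) -> B -> Prop) : Prop :=
  dense_in_L2 mu (dom T).

Definition comp_op (A B : operator) : operator :=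
  fun f g => exists2 k, B f k & A k g.

(* a A + b B, with domain D(A) `&` D(B) *)
Definition lincomb_op (a : R[i]) (A : operator) (b : R[i]) (B : operator) :
    operator :=
  fun f g => exists g1 g2, [/\ A f g1, B f g2, L2 mu g &
    eqL2 mu g (fun x => a * g1 x + b * g2 x)].

Definition adjoint (T : operator) : operator :=
  fun k f => [/\ L2 mu k, L2 mu f &
    forall u v, T u v -> dot mu v k = dot mu u f].

Definition positive_selfadjoint (P : operator) : Prop :=
  [/\ is_operator P, densely_defined P,
      forall f g, P f g <-> adjoint P f g
    & forall f g, P f g -> 0 <= dot mu g f].

(* A pair of operators, identified with the column operator
   f |-> (T_1 f, T_2 f) from L^2(mu) to L^2(mu) (+) L^2(mu). *)
Definition column (T : 'I_2 -> operator) :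
    (X -> R[i]) -> ('I_2 -> X -> R[i]) -> Prop :=
  fun f g => forall i, T i f (g i).

Definition column_adjoint (T : 'I_2 -> operator) :
    ('I_2 -> X -> R[i]) -> (X -> R[i]) -> Prop :=
  fun k f => [/\ forall i, L2 mu (k i), L2 mu f &
    forall u v, column T u v -> \sum_(i < 2) dot mu (v i) (k i) = dot mu u f].

(* P = |T| = (T^* T)^(1/2) *)
Definition is_modulus (T : 'I_2 -> operator) (P : operator) : Prop :=
  positive_selfadjoint P /\
  forall f g, comp_op P P f g <->
    exists2 k, column T f k & column_adjoint T k g.

Definition column_kernel (T : 'I_2 -> operator) : set (X -> R[i]) :=
  [set f | column T f (fun _ _ => 0)].

Definition column_partial_isometry (U : 'I_2 -> operator) : Prop :=
  [/\ forall i, is_operator (U i),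
      forall f, L2 mu f -> dom (column U) f,
      exists M : R, forall f v, column U f v ->
        (\sum_(i < 2) norm2 mu (v i) <= M%:E * norm2 mu f)%E
    & forall f v, (forall k, column_kernel U k -> dot mu f k = 0) ->
        column U f v -> (\sum_(i < 2) norm2 mu (v i) = norm2 mu f)%E].

(* T = U P with P = |T| and U a partial isometry with the same kernel as T *)
Definition is_polar_decomposition (T U : 'I_2 -> operator) (P : operator) :
    Prop :=
  [/\ is_modulus T P, column_partial_isometry U,
      column_kernel U = column_kernel T
    & forall f v, column T f v <-> exists2 g, P f g & column U g v].

Definition spherical_mean_transform (lambda : R) (U : 'I_2 -> operator)
    (P : operator) : 'I_2 -> operator :=
  fun i => lincomb_op lambda%:C (comp_op (U i) P)
                      (1 - lambda)%:C (comp_op P (U i)).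

End Operators.

Section WeightedComposition.
Context d (X : measurableType d) (R : realType).
Variable mu : {measure set X -> \bar R}.
Implicit Types (phi : X -> X) (w : X -> R[i]) (f h E F : X -> \bar R).

Definition wcomp phi w : operator X R :=
  fun u v => [/\ L2 mu u, L2 mu v & eqL2 mu v (fun x => w x * u (phi x))].

Definition wmeasure w : set X -> \bar R :=
  fun D => (\int[mu]_(x in D) (sqmod (w x))%:E)%E.

(* h is a version of h_(phi, w), the density of mu_w o phi^-1 w.r.t. mu *)
Definition is_RN phi w h : Prop :=
  [/\ measurable_fun setT h, forall x, (0 <= h x)%E &
      forall D, measurable D ->
        wmeasure w (phi @^-1` D) = (\int[mu]_(x in D) h x)%E].

(* E is a version of E_(phi, w)(f) *)
Definition is_condexp phi w f E : Prop :=
  [/\ @measurable_fun _ _ (g_sigma_algebra_preimageType phi) (\bar R) setT E,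
      forall x, (0 <= E x)%E &
      forall D, measurable D ->
        (\int[wmeasure w]_(x in phi @^-1` D) f x =
         \int[wmeasure w]_(x in phi @^-1` D) E x)%E].

(* F is a version of E o phi^-1, where h is a version of h_(phi, w) *)
Definition is_condexp_pullback phi w h E F : Prop :=
  [/\ measurable_fun setT F,
      {ae mu, forall x, h x = 0%E -> F x = 0%E} &
      {ae wmeasure w, forall x, F (phi x) = E x}].

(* the restriction of m to the sigma-algebra phi^-1(A) is sigma-finite *)
Definition sigma_finite_on_preimage phi (m : set X -> \bar R) : Prop :=
  @sigma_finite _ (g_sigma_algebra_preimageType phi) R setT m.

(* [fine] sends +oo to 0, which is harmless as f < +oo holds
   mu-a.e. in all uses. *)
Definition sqrt_weight f w : X -> R[i] :=
  fun x => (Num.sqrt (fine (f x)))%:C * w x.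

Definition eta phi w f : X -> R :=
  fun x => if w x == 0 then 0 else Num.sqrt (fine (f x) / fine (f (phi x))).

(* w_lambda, for f a version of h_(phi_1, w_1) + h_(phi_2, w_2) *)
Definition mean_weight (lambda : R) phi w f : X -> R[i] :=
  fun x => (eta phi w f x + lambda * (1 - eta phi w f x))%:C * w x.

End WeightedComposition.

(* Main.v *)
Require Import Defs.
From mathcomp Require Import all_boot all_order all_algebra.
From mathcomp Require Import complex.
From mathcomp Require Import all_classical all_reals all_analysis.
From mathcomp Require Import measurable_realfun.
From mathcomp Require Import ring.
From HB Require Import structures.
Import Order.TTheory GRing.Theory Num.Theory.
Import numFieldNormedType.Exports.
Local Open Scope classical_set_scope.
Local Open Scope ring_scope.

(** Every condition is a statement about densities, once the polar
    decomposition of the pair [T = (C_1, C_2)], [C_i f = w_i (f o phi_i)],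
    is known explicitly. Write [s = sqrt H], [H = h_1 + h_2].

    The operator part. By change of variables, [|w_i (f o phi_i)|^2] has
    integral [int h_i |f|^2], so [T^* T f = H f] for all [f] supported in a
    set [{s < n}]. Hence [|T|] is a positive self-adjoint operator whose
    square extends the multiplication by [s^2] on these functions, and it
    must be the multiplication by [s] (lemma [modulus_multiplication]). This
    uniqueness of the square root is proved by hand: on a slice where [s] is
    within [1/m] of a constant [a], the element [d = (|T| - a) f] satisfies
    [(|T| + a) d = (s^2 - a^2) f], and [|T| + a] is bounded below by [a]
    because [|T|] is positive; so [|T| f] and [s f] differ by [O(1/m)] on
    each slice, and adding up the slices leaves an error that vanishes with
    [1/m]. Since [U (s f) = T f] and [ker U = ker T], it follows that [U_i g
    = w_i ((g / s) o phi_i)], with [g / s = 0] where [s = 0] (lemma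
    [polar_isometryE]). Both summands of the mean transform are then
    explicit, and they add up to the weight [w_lambda] (theorem
    [spherical_mean_transformE]).

    The measure part. Conditioning on [phi_i^-1(A)] shows that the measure
    with density [f |w_i|^2] is transported by [phi_i] to the measure with
    density [h_i F], where [F = E(f) o phi_i^-1] (lemma [condexp_RN]). A
    measure with density [G] with respect to a sigma-finite measure is
    sigma-finite exactly when [G < +oo] almost everywhere; moreover [h_i] is
    finite and [F] vanishes where [h_i] does, up to null sets, so finiteness
    of [F] is equivalent to sigma-finiteness of the transported measure. For
    [f = H] and [f = h_j] this links the conditional expectations with the
    measures, and additivity in [f] links [H] with the two [h_j]. Finally,
    [w_lambda] is [w_i] times [lambda + (1 - lambda) eta_i] with [eta_i >=
    0], so the domain of the operator with weight [w_lambda] consists of the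
    [f] in [L^2] with [int kappa_i |f|^2 < +oo], where [kappa_i = h_i + h_i
    F / H]; such a domain is dense exactly when [kappa_i] is finite almost
    everywhere (lemma [dense_weighted_L2P]), that is, when [F] is. *)

Set Implicit Arguments.
Unset Strict Implicit.
Unset Printing Implicit Defensive.

(** * Measures with a density *)

Section Density.
Local Open Scope ereal_scope.
Context d (X : measurableType d) (R : realType).
Import HBNNSimple.
Variables (mu : {measure set X -> \bar R}) (g : X -> \bar R).
Hypotheses (mg : measurable_fun setT g) (g0 : forall x, 0 <= g x).

Definition density (D : set X) : \bar R := \int[mu]_(x in D) g x.

Let density0 : density set0 = 0.
Proof. exact: integral_set0. Qed.

Let density_ge0 D : 0 <= density D.
Proof. exact: integral_ge0. Qed.

Let density_sigma_additive : semi_sigma_additive density.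
Proof.
move=> F mF tF mUF; rewrite /density ge0_integral_bigcup//; last first.
  exact: measurable_funTS.
by apply: is_cvg_ereal_nneg_natsum_cond => n _ _; exact: integral_ge0.
Qed.

HB.instance Definition _ := isMeasure.Build _ _ _ density
  density0 density_ge0 density_sigma_additive.

(** The measure structure of [density] depends on the proofs [mg] and [g0],
    which cannot be inferred from the function; this copy carries them along. *)
Definition density_measure : {measure set X -> \bar R} := density.

Lemma integral_density_nnsfun (f : {nnsfun X >-> R}) :
  \int[density]_x (f x)%:E = \int[mu]_x (g x * (f x)%:E).
Proof.
rewrite integralT_nnsfun sintegralE.
under [RHS]eq_integral => x _.
  rewrite fimfunE -fsumEFin// ge0_mule_fsumr//; last first.
    by move=> r; rewrite nnfun_muleindic_ge0.
  over.
rewrite ge0_integral_fsum//; last 2 first.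
- move=> r; apply: emeasurable_funM => //.
  exact/measurable_EFinP/measurable_funM.
- by move=> r x _; rewrite mule_ge0// nnfun_muleindic_ge0.
apply: eq_fsbigr => r; rewrite inE => -[y _ yr].
have r0 : (0 <= r)%R by rewrite -yr.
rewrite /= /density [X in _ * X]integral_mkcond.
under [RHS]eq_integral do rewrite EFinM muleCA.
rewrite ge0_integralZl//.
- congr (_ * _); apply: eq_integral => x _.
  by rewrite patchE indicE; case: ifPn => _; rewrite ?mule1 ?mule0.
- apply: emeasurable_funM => //; apply/measurable_EFinP.
  exact: measurable_indic.
- by move=> x _; rewrite mule_ge0// lee_fin.
Qed.

(** Monotone convergence from simple functions. Where [g x = +oo] and [f x = 0]
    the limit of the products is of the form [+oo * 0], but there all the
    simple approximations of [f] vanish too. *)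
Lemma ge0_integral_density (f : X -> \bar R) :
  measurable_fun setT f -> (forall x, 0 <= f x) ->
  \int[density]_x f x = \int[mu]_x (g x * f x).
Proof.
move=> mf f0; pose f_ := nnsfun_approx measurableT mf.
transitivity (limn (fun n => \int[density]_x (f_ n x)%:E)).
  rewrite -monotone_convergence//.
  - apply: eq_integral => x _; apply/esym/cvg_lim => //.
    exact: cvg_nnsfun_approx.
  - by move=> n; exact/measurable_EFinP/measurable_funP.
  - by move=> n y _; rewrite lee_fin.
  - by move=> y _ m n mn; rewrite lee_fin; exact/lefP/nd_nnsfun_approx.
under eq_fun do rewrite integral_density_nnsfun.
rewrite -monotone_convergence//.
- apply: eq_integral => x _; apply/cvg_lim => //.
  have cf : (f_ n x)%:E @[n --> \oo] --> f x by exact: cvg_nnsfun_approx.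
  have [fx0|fx0] := eqVneq (f x) 0.
    have fn0 n : f_ n x = 0%R.
      apply/eqP; rewrite eq_le; apply/andP; split; last exact: fun_ge0.
      rewrite -lee_fin -[leRHS]fx0 /f_ nnsfun_approxE.
      exact: le_approx.
    under eq_fun do rewrite fn0 mule0.
    rewrite fx0 mule0; exact: cvg_cst.
  have [gx0|gx0] := eqVneq (g x) 0.
    under eq_fun do rewrite gx0 mul0e.
    rewrite gx0 mul0e; exact: cvg_cst.
  apply: cvgeM => //; last exact: cvg_cst.
  by rewrite mule_defE/= (negbTE fx0) (negbTE gx0).
- move=> n; apply: emeasurable_funM => //.
  exact/measurable_EFinP/measurable_funP.
- by move=> n x _; rewrite mule_ge0 ?lee_fin.
- move=> x _ m n mn; rewrite lee_wpmul2l ?lee_fin//.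
  exact/lefP/nd_nnsfun_approx.
Qed.
End Density.

(** * Complex-valued functions *)

Section SqMod.
Local Open Scope complex_scope.
Variable R : realType.
Implicit Types (z w : R[i]) (c : R).

Lemma sqmod_ge0 z : 0 <= sqmod z.
Proof. by rewrite addr_ge0// sqr_ge0. Qed.

Lemma sqmod0 : sqmod (0 : R[i]) = 0.
Proof. by rewrite /sqmod /= expr0n addr0. Qed.

Lemma sqmodM z w : sqmod (z * w) = sqmod z * sqmod w.
Proof. by case: z w => [a b] [a' b']; rewrite /sqmod /=; ring. Qed.

Lemma sqmod_real c : sqmod c%:C = c ^+ 2.
Proof. by rewrite /sqmod /= expr0n addr0. Qed.

Lemma sqmodZ c z : sqmod (c%:C * z) = c ^+ 2 * sqmod z.
Proof. by rewrite sqmodM sqmod_real. Qed.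

Lemma sqmod_eq0 z : (sqmod z == 0) = (z == 0).
Proof.
by case: z => a b; rewrite /sqmod /= paddr_eq0 ?sqr_ge0// !sqrf_eq0 eq_complex.
Qed.

Lemma sqmodEFin0 z : (sqmod z)%:E = 0%E -> z = 0.
Proof. by move=> /eqP; rewrite eqe sqmod_eq0 => /eqP. Qed.

Lemma sqmodN z : sqmod (- z) = sqmod z.
Proof. by case: z => a b; rewrite /sqmod /= !sqrrN. Qed.

(** Young's inequality. Choosing [t] equal to the number of terms already
    summed makes an iterated use cost a factor linear in the number of terms. *)
Lemma sqmodD_weighted (t : R) z w : 0 < t ->
  sqmod (z + w) <= (1 + t^-1) * sqmod z + (1 + t) * sqmod w.
Proof.
move=> t0; have t0' : t != 0 by rewrite gt_eqF.
rewrite -subr_ge0 [leRHS](_ : _ = t^-1 * sqmod (z - t%:C * w)).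
  by rewrite mulr_ge0 ?sqmod_ge0// invr_ge0 ltW.
by case: z w => [a b] [a' b']; rewrite /sqmod /=; field.
Qed.

Lemma conjcD z w : conjc (z + w) = conjc z + conjc w.
Proof. by case: z w => [a b] [a' b'] /=; rewrite opprD. Qed.

Lemma conjcZ c z : conjc (c%:C * z) = c%:C * conjc z.
Proof.
case: z => a b; apply/eqP; rewrite eq_complex/=.
by apply/andP; split; apply/eqP; ring.
Qed.

End SqMod.

Section Measurability.
Local Open Scope complex_scope.
Context d (X : measurableType d) (R : realType).
Implicit Types (f g : X -> R[i]) (c : X -> R).

Lemma measurable_sqmod f : cmeasurable f ->
  measurable_fun setT (fun x => sqmod (f x)).
Proof. by move=> [mr mi]; apply: measurable_funD; exact: measurable_funX. Qed.

Lemma cmeasurableD f g : cmeasurable f -> cmeasurable g ->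
  cmeasurable (fun x => f x + g x).
Proof.
move=> [fr fi] [gr gi]; split.
  rewrite (_ : (fun x => _) = (fun x => complex.Re (f x) + complex.Re (g x))).
    exact: measurable_funD.
  by apply/funext => x; case: (f x) (g x) => [? ?] [].
rewrite (_ : (fun x => _) = (fun x => complex.Im (f x) + complex.Im (g x))).
  exact: measurable_funD.
by apply/funext => x; case: (f x) (g x) => [? ?] [].
Qed.

Lemma cmeasurableM f g : cmeasurable f -> cmeasurable g ->
  cmeasurable (fun x => f x * g x).
Proof.
move=> [fr fi] [gr gi]; split.
  rewrite (_ : (fun x => _) = (fun x => complex.Re (f x) * complex.Re (g x) -
      complex.Im (f x) * complex.Im (g x))).
    by apply: measurable_funB; exact: measurable_funM.
  by apply/funext => x; case: (f x) (g x) => [? ?] [].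
rewrite (_ : (fun x => _) = (fun x => complex.Re (f x) * complex.Im (g x) +
    complex.Im (f x) * complex.Re (g x))).
  by apply: measurable_funD; exact: measurable_funM.
by apply/funext => x; case: (f x) (g x) => [? ?] [].
Qed.

Lemma cmeasurable_cst (z : R[i]) : cmeasurable (fun _ : X => z).
Proof. by split; exact: measurable_cst. Qed.

Lemma cmeasurable_real c : measurable_fun setT c ->
  cmeasurable (fun x => (c x)%:C).
Proof. by move=> mc; split => //; exact: measurable_cst. Qed.

Lemma cmeasurable_conj f : cmeasurable f -> cmeasurable (fun x => conjc (f x)).
Proof.
move=> [fr fi]; split.
  by rewrite (_ : (fun x => _) = (fun x => complex.Re (f x)))//;
    apply/funext => x; case: (f x).
rewrite (_ : (fun x => _) = (fun x => - complex.Im (f x))).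
  by apply: measurable_funN.
by apply/funext => x; case: (f x).
Qed.

Lemma cmeasurable_comp (phi : X -> X) f : measurable_fun setT phi ->
  cmeasurable f -> cmeasurable (fun x => f (phi x)).
Proof.
move=> mp [fr fi].
by split; [exact: (measurableT_comp fr mp)|exact: (measurableT_comp fi mp)].
Qed.

Lemma cmeasurableZ c f : measurable_fun setT c -> cmeasurable f ->
  cmeasurable (fun x => (c x)%:C * f x).
Proof. by move=> mc; apply: cmeasurableM; exact: cmeasurable_real. Qed.

Lemma cmeasurableN f : cmeasurable f -> cmeasurable (fun x => - f x).
Proof.
move=> mf; under eq_fun do rewrite -mulN1r.
by apply: cmeasurableM => //; exact: cmeasurable_cst.
Qed.

Lemma cmeasurableB f g : cmeasurable f -> cmeasurable g ->
  cmeasurable (fun x => f x - g x).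
Proof. by move=> mf mg; apply: cmeasurableD => //; exact: cmeasurableN. Qed.

Lemma measurable_sqrt_fine (h : X -> \bar R) : measurable_fun setT h ->
  measurable_fun setT (fun x => Num.sqrt (fine (h x))).
Proof.
move=> mh.
apply: (measurableT_comp (continuous_measurable_fun (@sqrt_continuous R))).
exact: (measurableT_comp (fine_measurable measurableT)).
Qed.

Lemma emeasurable_sqmod f : cmeasurable f ->
  measurable_fun setT (fun x => (sqmod (f x))%:E).
Proof. by move=> mf; apply/measurable_EFinP; exact: measurable_sqmod. Qed.

End Measurability.

(** * Change of variables for the transported measure *)

Section RadonNikodym.
Local Open Scope complex_scope.
Local Open Scope ereal_scope.
Context d (X : measurableType d) (R : realType).
Variable mu : {measure set X -> \bar R}.
Implicit Types (phi : X -> X) (w : X -> R[i]) (h f : X -> \bar R).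

Lemma ge0_integral_eq0P f D : measurable D -> measurable_fun setT f ->
  (forall x, 0 <= f x) ->
  \int[mu]_(x in D) f x = 0 <-> {ae mu, forall x, D x -> f x = 0}.
Proof.
move=> mD mf f0.
have := ae_eq_integral_abs mu mD (measurable_funTS mf).
by under eq_integral => x _ do rewrite (gee0_abs (f0 x)).
Qed.

Lemma integral_wmeasure w f : cmeasurable w -> measurable_fun setT f ->
  (forall x, 0 <= f x) ->
  \int[wmeasure mu w]_x f x = \int[mu]_x ((sqmod (w x))%:E * f x).
Proof.
move=> mw mf f0.
have mg := emeasurable_sqmod mw.
have g0 x : 0 <= (sqmod (w x))%:E by rewrite lee_fin sqmod_ge0.
exact: (ge0_integral_density mu mg g0 mf f0).
Qed.

Lemma integral_wmeasure_in w f D : cmeasurable w -> measurable_fun setT f ->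
  (forall x, 0 <= f x) -> measurable D ->
  \int[wmeasure mu w]_(x in D) f x =
  \int[mu]_(x in D) ((sqmod (w x))%:E * f x).
Proof.
move=> mw mf f0 mD; rewrite [RHS]integral_mkcond.
rewrite [LHS](_ : _ = \int[wmeasure mu w]_x (f \_ D) x); last first.
  by rewrite /integral patch_setT.
rewrite integral_wmeasure//.
- apply: eq_integral => x _; rewrite !patchE; case: ifPn => //.
  by rewrite mule0.
- by apply/(measurable_restrictT _ mD)/measurable_funTS.
- by move=> x; rewrite patchE; case: ifPn.
Qed.

(** The density of [mu_w] vanishes exactly where [w] does. *)
Lemma ae_wmeasureP w (Q : X -> Prop) : cmeasurable w ->
  {ae wmeasure mu w, forall x, Q x} <->
  {ae mu, forall x, w x != 0%R -> Q x}.
Proof.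
move=> mw; have mg := emeasurable_sqmod mw.
have g0 x : 0 <= (sqmod (w x))%:E by rewrite lee_fin sqmod_ge0.
split=> [[B [mB B0 QB]]|[B [mB B0 QB]]].
- move/(ge0_integral_eq0P mB mg g0) : B0; apply: filterS => x Bx wx0.
  apply: contrapT => nQ; have /Bx : B x by apply: QB.
  by move/sqmodEFin0/eqP; rewrite (negbTE wx0).
- pose C := [set x | (sqmod (w x))%:E = 0].
  have mC : measurable C.
    by rewrite -[C]setTI; exact: (mg measurableT [set 0] (emeasurable_set1 0)).
  exists (B `|` C); split; first exact: measurableU.
    apply/(ge0_integral_eq0P _ mg g0); first exact: measurableU.
    exists B; split => // x /not_implyP [[//|Cx]].
    by move=> /(_ Cx).
  move=> x nQ; have [wx0|wx0] := eqVneq (w x) 0%R.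
    by right; rewrite /C/= wx0 sqmod0.
  by left; apply: QB => /(_ wx0).
Qed.

Section Transport.
Variables (phi : X -> X) (w : X -> R[i]) (h : X -> \bar R).
Hypotheses (mphi : measurable_fun setT phi) (mw : cmeasurable w)
  (hP : is_RN mu phi w h).

Let mpre D : measurable D -> measurable (phi @^-1` D).
Proof. by move=> mD; rewrite -[_ @^-1` _]setTI; exact: mphi. Qed.

(** Both sides integrate [f] against the measure [mu_w o phi^-1], seen on the
    left as an image measure and on the right through its density. *)
Lemma RN_change_of_variables f : measurable_fun setT f ->
  (forall x, 0 <= f x) ->
  \int[mu]_x ((sqmod (w x))%:E * f (phi x)) = \int[mu]_x (h x * f x).
Proof.
move=> mf f0; have [mh h0 hE] := hP.
rewrite -(ge0_integral_density mu mh h0 mf f0).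
have mg := emeasurable_sqmod mw.
have g0 x : 0 <= (sqmod (w x))%:E by rewrite lee_fin sqmod_ge0.
rewrite -(@ge0_integral_density _ _ _ mu (fun x => (sqmod (w x))%:E)
  mg g0 (f \o phi))//=; last first.
  exact: measurableT_comp.
have := @ge0_integral_pushforward _ _ _ _ _ phi mphi
  (density_measure mu mg g0) setT f
  measurableT mf (fun x _ => f0 x).
rewrite preimage_setT => <-.
apply: eq_measure_integral => D mD _.
exact: hE.
Qed.

(** Both sides say that [mu_w o phi^-1] gives no mass to [D]. *)
Lemma RN_preimage_null D : measurable D ->
  {ae wmeasure mu w, forall x, ~ D (phi x)} <->
  {ae mu, forall x, D x -> h x = 0}.
Proof.
move=> mD; have [mh h0 hE] := hP.
have mg := emeasurable_sqmod mw.
have g0 x : 0 <= (sqmod (w x))%:E by rewrite lee_fin sqmod_ge0.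
rewrite -(ge0_integral_eq0P mD mh h0) -hE//.
rewrite ae_wmeasureP//.
rewrite (ge0_integral_eq0P (mpre mD) mg g0).
split; apply: filterS => x; rewrite /preimage/= => H.
- move=> Dx; apply/eqP; rewrite eqe sqmod_eq0; apply/negPn/negP => /H; exact.
- by move=> wx0 /H/sqmodEFin0/eqP; rewrite (negbTE wx0).
Qed.

End Transport.
End RadonNikodym.

(** * Conditional expectations and sigma-finiteness *)

Section CondExp.
Local Open Scope complex_scope.
Local Open Scope ereal_scope.
Context d (X : measurableType d) (R : realType).
Variable mu : {measure set X -> \bar R}.
Variables (phi : X -> X) (w : X -> R[i]) (h : X -> \bar R).
Hypotheses (mphi : measurable_fun setT phi) (mw : cmeasurable w)
  (hP : is_RN mu phi w h).

Let mpre D : measurable D -> measurable (phi @^-1` D).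
Proof. by move=> mD; rewrite -[_ @^-1` _]setTI; exact: mphi. Qed.

(** [mu_w o phi^-1] only sees the set where [h] is positive, and elsewhere [F]
    vanishes, so that an infinite value of [F] is never lost. *)
Lemma condexp_pullback_finite E F : is_condexp_pullback mu phi w h E F ->
  {ae mu, forall x, F x < +oo} <-> {ae wmeasure mu w, forall x, E x < +oo}.
Proof.
move=> [mF Fh0 FE].
pose D := F @^-1` [set +oo].
have mD : measurable D.
  by rewrite -[D]setTI; exact: (mF measurableT _ (emeasurable_set1 _)).
have nD x : (F x < +oo) <-> ~ D x.
  by rewrite ltey /D/=; split => /eqP.
transitivity {ae mu, forall x, D x -> h x = 0}.
  split=> H.
    by move: H; apply: filterS => x /nD.
  move: Fh0 H; apply: filterS2 => x Fh0 Dh.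
  by apply/nD => Dx; have := Fh0 (Dh Dx); rewrite Dx.
rewrite -(RN_preimage_null mphi mw hP mD) !ae_wmeasureP//.
move: FE; rewrite ae_wmeasureP// => FE.
split; move: FE; apply: filterS2 => x FE H /[dup] wx0 /H.
- by rewrite -(FE wx0) => /nD.
- by rewrite -(FE wx0) => /nD.
Qed.

Lemma measurable_fun_preimage_algebra (E : X -> \bar R) :
  @measurable_fun _ _ (g_sigma_algebra_preimageType phi) (\bar R) setT E ->
  measurable_fun setT E.
Proof.
move=> mE _ B mB; have [D mD <-] := mE measurableT B mB.
by apply: measurableI => //; exact: mpre.
Qed.

Lemma cmeasurable_sqrt_weight f : measurable_fun setT f ->
  cmeasurable (sqrt_weight f w).
Proof.
by move=> mf; apply: cmeasurableZ => //; exact: measurable_sqrt_fine.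
Qed.

Lemma wmeasure_sqrt_weight f D : measurable D -> measurable_fun setT f ->
  (forall x, 0 <= f x) -> {ae mu, forall x, f x < +oo} ->
  wmeasure mu (sqrt_weight f w) D = \int[wmeasure mu w]_(x in D) f x.
Proof.
move=> mD mf f0 foo; rewrite integral_wmeasure_in//.
apply: ae_eq_integral => //.
- apply: measurable_funTS; apply: emeasurable_sqmod.
  exact: cmeasurable_sqrt_weight.
- apply: measurable_funTS; apply: emeasurable_funM => //.
  exact: emeasurable_sqmod.
- move: foo; apply: filterS => x fx _.
  have fxf : f x \is a fin_num by rewrite ge0_fin_numE.
  rewrite sqmodZ sqr_sqrtr ?fine_ge0// EFinM fineK// muleC//.
Qed.

(** Over a set [phi^-1(D)] one may replace [f] by its conditional expectation
    [F o phi], and the change of variables turns [F o phi] against [mu_w] into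
    [h F] against [mu]. [F] is nonnegative only almost everywhere, whence the
    truncation at 0. *)
Lemma condexp_RN f E F : measurable_fun setT f ->
  (forall x, 0 <= f x) -> {ae mu, forall x, f x < +oo} ->
  is_condexp mu phi w f E -> is_condexp_pullback mu phi w h E F ->
  is_RN mu phi (sqrt_weight f w) (fun x => h x * maxe (F x) 0).
Proof.
move=> mf f0 foo [mE E0 EE] [mF Fh0 FE]; have [mh h0 _] := hP.
have mG : measurable_fun setT (fun x => maxe (F x) 0).
  by apply: measurable_maxe => //; exact: measurable_cst.
have G0 x : 0 <= maxe (F x) 0 by rewrite le_max lexx orbT.
split=> [|x|D mD].
- exact: emeasurable_funM.
- by rewrite mule_ge0.
have mE' := measurable_fun_preimage_algebra mE.
have mpD := mpre mD.
rewrite wmeasure_sqrt_weight// EE// integral_wmeasure_in//.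
have mGD : measurable_fun setT ((fun x => maxe (F x) 0) \_ D).
  by apply/(measurable_restrictT _ mD)/measurable_funTS.
transitivity (\int[mu]_(x in phi @^-1` D)
    ((sqmod (w x))%:E * maxe (F (phi x)) 0)).
  apply: ae_eq_integral => //.
  - apply: measurable_funTS; apply: emeasurable_funM => //.
    exact: emeasurable_sqmod.
  - apply: measurable_funTS; apply: emeasurable_funM.
      exact: emeasurable_sqmod.
    exact: (measurableT_comp mG mphi).
  - move: FE; rewrite ae_wmeasureP//; apply: filterS => x FE _.
    have [->|wx0] := eqVneq (w x) 0%R; first by rewrite sqmod0 !mul0e.
    by rewrite (FE wx0) max_l.
rewrite integral_mkcond [RHS]integral_mkcond.
transitivity (\int[mu]_x ((sqmod (w x))%:E *
    ((fun x => maxe (F x) 0) \_ D) (phi x))).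
  apply: eq_integral => x _; rewrite !patchE.
  have -> : (x \in phi @^-1` D) = (phi x \in D) by apply/idP/idP; rewrite !inE.
  by case: ifPn => //; rewrite mule0.
rewrite (RN_change_of_variables mphi mw hP)//; last first.
  by move=> x; rewrite patchE; case: ifPn.
apply: eq_integral => x _; rewrite !patchE; case: ifPn => //.
by rewrite mule0.
Qed.

End CondExp.

Section SigmaFinite.
Local Open Scope complex_scope.
Local Open Scope ereal_scope.
Context d (X : measurableType d) (R : realType).

(** A cover of [X] by sets [phi^-1(G n)] yields sets [G n] that cover the range
    of [phi]; the complement of their union has empty preimage, so it can be
    added to the cover as a set of mass 0. *)
Lemma sigma_finite_preimageP (m : set X -> \bar R) (phi : X -> X) :
  m set0 = 0 ->
  sigma_finite setT (pushforward m phi) <-> sigma_finite_on_preimage phi m.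
Proof.
move=> m0; split=> [[F UF mF]|[F UF mF]].
  exists (fun n => phi @^-1` F n).
    by rewrite -preimage_bigcup -UF preimage_setT.
  move=> n; have [mFn Fn] := mF n; split => //.
  by exists (F n) => //; rewrite setTI.
have mF' n : {D | measurable D & phi @^-1` D = F n}.
  have [mFn _] := mF n.
  suff : exists2 D, measurable D & phi @^-1` D = F n by move=> /cid2.
  by case: mFn => D mD <-; exists D => //; rewrite setTI.
pose G n := s2val (mF' n).
have mG n : measurable (G n).
  exact: (s2valP (mF' n)).
have GE n : phi @^-1` (G n) = F n.
  exact: (s2valP' (mF' n)).
exists (fun n => if n is k.+1 then G k else ~` \bigcup_k G k).
  apply/esym; rewrite -subTset => x _.
  have [[k _ Gkx]|nG] := pselect ((\bigcup_k G k) x).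
    by exists k.+1.
  by exists 0%N.
case=> [|k]; last by split => //; rewrite /pushforward GE; have [] := mF k.
split; first by apply: measurableC; exact: bigcup_measurable.
rewrite /pushforward; have -> : phi @^-1` (~` \bigcup_k G k) = set0.
  rewrite -subset0 => x nGx.
  have [n _ Fnx] : (\bigcup_n F n) x by rewrite -UF.
  by apply: nGx; exists n => //; move: Fnx; rewrite -GE.
by rewrite m0.
Qed.

Variable mu : {sigma_finite_measure set X -> \bar R}.

(** [G] is integrable, hence almost everywhere finite, on a set of finite mass.
    Conversely the sets [{G <= k}] inside sets of finite [mu]-measure have
    finite mass, and [{G = +oo}] has mass 0. *)
Lemma density_sigma_finiteP G : measurable_fun setT G ->
  (forall x, 0 <= G x) ->
  sigma_finite setT (fun D => \int[mu]_(x in D) G x) <->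
  {ae mu, forall x, G x < +oo}.
Proof.
move=> mG G0; split=> [[F UF mF]|Goo].
- have H n : {ae mu, forall x, F n x -> G x < +oo}.
    have [mFn Fn] := mF n.
    have : mu.-integrable (F n) G.
      apply/integrableP; split; first exact: measurable_funTS.
      by under eq_integral => x _ do rewrite gee0_abs//.
    move/(integrable_ae mFn); apply: filterS => x H /H.
    by rewrite ge0_fin_numE.
  apply: (@negligibleS _ _ _ _ (\bigcup_n (~` [set x | F n x -> G x < +oo]))).
    move=> x/= nG; have : (\bigcup_n F n) x by rewrite -UF.
    by move=> [n _ Fnx]; exists n => // H'; apply: nG; exact: H'.
  by apply: negligible_bigcup => n; exact: H.
- have [A UA mA] := sigma_finiteT mu.
  pose B n := [set x | G x <= n%:R%:E].
  have mB n : measurable (B n).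
    rewrite -[B n]setTI; exact: emeasurable_fun_infty_c.
  pose D := G @^-1` [set +oo].
  have mD : measurable D.
    by rewrite -[D]setTI; exact: (mG measurableT _ (emeasurable_set1 _)).
  pose C (n k : nat) := A n `&` B k.
  pose F n := if n is m.+1 then
    (if unpickle m is Some nk then C nk.1 nk.2 else set0) else D.
  exists F.
    apply/esym; rewrite -subTset => x _.
    have [Gx|Gx] := eqVneq (G x) +oo; first by exists 0%N.
    have : (\bigcup_n A n) x by rewrite -UA.
    move=> [n _ Anx].
    have Gf : G x \is a fin_num by rewrite ge0_fin_numE// ltey.
    have [k Hk] : exists k : nat, G x <= k%:R%:E.
      exists (Num.truncn (fine (G x))).+1.
      rewrite -(fineK Gf) lee_fin; apply: ltW.
      exact: truncnS_gt.
    exists (pickle (n, k)).+1 => //=.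
    by rewrite pickleK.
  case=> [|m]/=.
    split=> //; rewrite (_ : \int[mu]_(x in D) G x = 0) ?lt0y//.
    apply/(ge0_integral_eq0P mu mD mG G0).
    move: Goo; apply: filterS => x Gx Dx.
    by move: Gx; rewrite Dx.
  case: unpickle => [[n k]|]/=; last by split => //; rewrite integral_set0.
  have [mAn An] := mA n.
  have mC : measurable (C n k) by exact: measurableI.
  split=> //.
  apply: (@le_lt_trans _ _ (\int[mu]_(x in C n k) (k%:R%:E))).
    apply: ge0_le_integral => //.
    - exact: measurable_funTS.
    - by move=> x [].
  rewrite integral_cst//.
  have Cfin : mu (C n k) < +oo.
    by apply: le_lt_trans An; apply: le_measure; rewrite ?inE//; apply: subIsetl.
  by rewrite lte_mul_pinfty// lee_fin.
Qed.

Variables (phi : X -> X) (w : X -> R[i]) (h : X -> \bar R).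
Hypotheses (mphi : measurable_fun setT phi) (mw : cmeasurable w)
  (hP : is_RN mu phi w h).

Lemma RN_sigma_finiteP :
  sigma_finite setT (pushforward (wmeasure mu w) phi) <->
  {ae mu, forall x, h x < +oo}.
Proof.
have [mh h0 hE] := hP; rewrite -(density_sigma_finiteP mh h0).
split=> -[F UF mF]; exists F => // n; have [mFn Fn] := mF n; split => //.
  by rewrite -hE.
by rewrite /pushforward hE.
Qed.

End SigmaFinite.

Section CondExpSigmaFinite.
Local Open Scope complex_scope.
Local Open Scope ereal_scope.
Context d (X : measurableType d) (R : realType).
Variable mu : {sigma_finite_measure set X -> \bar R}.
Variables (phi : X -> X) (w : X -> R[i]) (h : X -> \bar R).
Hypotheses (mphi : measurable_fun setT phi) (mw : cmeasurable w)
  (hP : is_RN mu phi w h) (hoo : {ae mu, forall x, h x < +oo}).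

(** Where [h] is positive, [F = +oo] makes the product infinite; where [h]
    vanishes, so does [F]. *)
Lemma condexp_density_finite E F : is_condexp_pullback mu phi w h E F ->
  {ae mu, forall x, h x * maxe (F x) 0 < +oo} <-> {ae mu, forall x, F x < +oo}.
Proof.
move=> [mF Fh0 FE]; have [mh h0 _] := hP; split.
- move: Fh0; apply: filterS2 => x Fh0.
  have [hx0|hx0] := eqVneq (h x) 0; first by rewrite Fh0.
  have hx : 0 < h x by rewrite lt0e hx0 h0.
  rewrite !ltey => /eqP hF; apply/eqP => Foo; apply: hF.
  by rewrite Foo maxye gt0_muley.
- move: hoo; apply: filterS2 => x hx Fx.
  apply: lte_mul_pinfty => //; first by rewrite ge0_fin_numE.
  by rewrite gt_max Fx ltry.
Qed.

Lemma sigma_finite_condexpP f E F : measurable_fun setT f ->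
  (forall x, 0 <= f x) -> {ae mu, forall x, f x < +oo} ->
  is_condexp mu phi w f E -> is_condexp_pullback mu phi w h E F ->
  sigma_finite setT (pushforward (wmeasure mu (sqrt_weight f w)) phi) <->
  {ae mu, forall x, F x < +oo}.
Proof.
move=> mf f0 foo EP FP; rewrite -(condexp_density_finite FP).
apply: RN_sigma_finiteP => //.
exact: (condexp_RN mphi mw hP mf f0 foo EP FP).
Qed.

End CondExpSigmaFinite.

(** * Square-integrable functions and weighted domains *)

Section SquareIntegrable.
Local Open Scope complex_scope.
Context d (X : measurableType d) (R : realType).
Variable mu : {measure set X -> \bar R}.
Implicit Types (f g : X -> R[i]) (c : X -> R) (E D : set X).

Lemma norm2_ge0 f : (0 <= norm2 mu f)%E.
Proof. by apply: integral_ge0 => x _; rewrite lee_fin sqmod_ge0. Qed.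

Lemma norm2_le (k : R) f g : 0 <= k -> cmeasurable f -> cmeasurable g ->
  {ae mu, forall x, sqmod (f x) <= k * sqmod (g x)} ->
  (norm2 mu f <= k%:E * norm2 mu g)%E.
Proof.
move=> k0 mf mg fg; rewrite /norm2 -ge0_integralZl//.
- apply: ae_ge0_le_integral => //.
  + by move=> x _; rewrite lee_fin sqmod_ge0.
  + exact: emeasurable_sqmod.
  + by move=> x _; rewrite mule_ge0// lee_fin// sqmod_ge0.
  + apply: emeasurable_funM => //; exact: emeasurable_sqmod.
  + by move: fg; apply: filterS => x fgx _; rewrite -EFinM lee_fin.
- exact: emeasurable_sqmod.
- by move=> x _; rewrite lee_fin sqmod_ge0.
Qed.

Lemma L2_le (k : R) f g : 0 <= k -> cmeasurable f -> L2 mu g ->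
  {ae mu, forall x, sqmod (f x) <= k * sqmod (g x)} -> L2 mu f.
Proof.
move=> k0 mf [mg g2] fg; split => //.
apply: (le_lt_trans (norm2_le k0 mf mg fg)).
by apply: lte_mul_pinfty.
Qed.

Lemma eqL2_norm2 f g : cmeasurable f -> cmeasurable g -> eqL2 mu f g ->
  norm2 mu f = norm2 mu g.
Proof.
move=> mf mg fg; apply: ae_eq_integral => //.
- exact: emeasurable_sqmod.
- exact: emeasurable_sqmod.
- by move: fg; apply: filterS => x ->.
Qed.

Lemma eqL2_L2 f g : L2 mu f -> cmeasurable g -> eqL2 mu g f -> L2 mu g.
Proof.
move=> [mf f2] mg gf; split => //.
by rewrite (eqL2_norm2 mg mf gf).
Qed.

Lemma norm2_eq0 f : cmeasurable f -> norm2 mu f = 0%E <-> eqL2 mu f (fun=> 0).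
Proof.
move=> mf; rewrite ge0_integral_eq0P//; last 2 first.
- exact: emeasurable_sqmod.
- by move=> x; rewrite lee_fin sqmod_ge0.
split; apply: filterS => x; first by move=> /(_ I)/sqmodEFin0.
by move=> -> _; rewrite sqmod0.
Qed.

Lemma L2_0 : L2 mu (fun=> 0).
Proof.
split; first exact: cmeasurable_cst.
rewrite (_ : norm2 _ _ = 0%E) ?ltry//.
by apply/norm2_eq0; [exact: cmeasurable_cst|exact: aeW].
Qed.

Lemma norm2D_weighted (t : R) f g : 0 < t -> cmeasurable f -> cmeasurable g ->
  (norm2 mu (fun x => (f x + g x)%R) <=
   (1 + t^-1)%:E * norm2 mu f + (1 + t)%:E * norm2 mu g)%E.
Proof.
move=> t0 mf mg.
have c1 : 0 <= 1 + t^-1 by rewrite addr_ge0// invr_ge0 ltW.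
have c2 : 0 <= 1 + t by rewrite addr_ge0// ltW.
have sq0 h (x : X) : (0 <= (sqmod (h x : R[i]))%:E)%E.
  by rewrite lee_fin sqmod_ge0.
have m2 (c : R) h : cmeasurable h ->
    measurable_fun setT (fun x : X => c%:E * (sqmod (h x : R[i]))%:E)%E.
  by move=> mh; apply: emeasurable_funM => //; exact: emeasurable_sqmod.
rewrite /norm2 -!ge0_integralZl//; try exact: emeasurable_sqmod.
have p2 (c : R) h (x : X) : 0 <= c -> (0 <= c%:E * (sqmod (h x : R[i]))%:E)%E.
  by move=> c0; rewrite mule_ge0.
rewrite -ge0_integralD//; [|by move=> x _; exact: p2|exact: m2
  |by move=> x _; exact: p2|exact: m2].
apply: ge0_le_integral => //.
- by move=> x _; rewrite lee_fin sqmod_ge0.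
- by apply: emeasurable_sqmod; exact: cmeasurableD.
- by apply: emeasurable_funD; exact: m2.
- by move=> x _; rewrite -!EFinM -EFinD lee_fin sqmodD_weighted.
Qed.

Lemma norm2D_le f g : cmeasurable f -> cmeasurable g ->
  (norm2 mu (fun x => (f x + g x)%R) <=
   2%:E * norm2 mu f + 2%:E * norm2 mu g)%E.
Proof.
move=> mf mg; have := norm2D_weighted ltr01 mf mg.
by rewrite invr1 -[1 + 1]/2.
Qed.

Lemma L2D f g : L2 mu f -> L2 mu g -> L2 mu (fun x => f x + g x).
Proof.
move=> [mf f2] [mg g2]; split; first exact: cmeasurableD.
apply: (le_lt_trans (norm2D_le mf mg)).
by apply: lte_add_pinfty; apply: lte_mul_pinfty.
Qed.

Lemma L2Zl (a : R[i]) f : L2 mu f -> L2 mu (fun x => a * f x).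
Proof.
move=> f2; have [mf _] := f2; apply: (@L2_le (sqmod a) _ f) => //.
- exact: sqmod_ge0.
- by apply: cmeasurableM => //; exact: cmeasurable_cst.
- by apply: aeW => x; rewrite sqmodM.
Qed.

Lemma L2B f g : L2 mu f -> L2 mu g -> L2 mu (fun x => f x - g x).
Proof.
move=> f2 g2; have := L2D f2 (L2Zl (-1) g2).
by under eq_fun do rewrite mulN1r.
Qed.

Lemma L2M (k : R) c f : measurable_fun setT c -> (forall x, `|c x| <= k) ->
  L2 mu f -> L2 mu (fun x => (c x)%:C * f x).
Proof.
move=> mc ck f2; have [mf _] := f2.
apply: (@L2_le (k ^+ 2) _ f) => //; first exact: sqr_ge0.
  exact: cmeasurableZ.
apply: aeW => x; rewrite sqmodZ ler_wpM2r ?sqmod_ge0//.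
by rewrite -(real_normK (num_real (c x))) lerXn2r// nnegrE (le_trans _ (ck x)).
Qed.

Definition cut E f : X -> R[i] := fun x => (\1_E x)%:C * f x.

Lemma cutE E f x : cut E f x = if x \in E then f x else 0.
Proof. by rewrite /cut indicE; case: ifPn => _; rewrite ?mul1r ?mul0r. Qed.

Lemma cmeasurable_cut E f : measurable E -> cmeasurable f ->
  cmeasurable (cut E f).
Proof. by move=> mE mf; apply: cmeasurableZ => //; exact: measurable_indic. Qed.

Lemma L2_cut E f : measurable E -> L2 mu f -> L2 mu (cut E f).
Proof.
move=> mE; apply: (@L2M 1); first exact: measurable_indic.
by move=> x; rewrite indicE; case: (x \in E); rewrite ?normr1 ?normr0.
Qed.

Lemma norm2_cut E f : measurable E ->
  norm2 mu (cut E f) = (\int[mu]_(x in E) (sqmod (f x))%:E)%E.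
Proof.
move=> mE; rewrite [RHS]integral_mkcond; apply: eq_integral => x _.
by rewrite patchE cutE; case: ifPn => // _; rewrite sqmod0.
Qed.

(** By dominated convergence. Limits are taken below by exhausting [X] with
    sets where some function is bounded, and this controls what is left out. *)
Lemma tail_integral (f : X -> \bar R) (E : nat -> set X) (e : R) :
  measurable_fun setT f -> (forall x, 0 <= f x)%E ->
  (\int[mu]_x f x < +oo)%E -> (forall n, measurable (E n)) ->
  {ae mu, forall x, \forall n \near \oo, ~ E n x} -> 0 < e ->
  exists n, (\int[mu]_(x in E n) f x < e%:E)%E.
Proof.
move=> mf f0 fi mE nE e0.
have If : mu.-integrable setT f.
  apply/integrableP; split => //.
  by under eq_integral do rewrite gee0_abs//.
have [] := @dominated_convergence _ _ _ mu setT measurableT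
  (fun n => f \_ (E n)) (fun=> 0%E) f.
- move=> n; apply/(measurable_restrictT _ (mE n)); exact: measurable_funTS.
- exact: measurable_cst.
- move: nE; apply: filterS => x Ex _.
  apply: cvg_near_cst; move: Ex; apply: filterS => n nEn.
  by rewrite patchE memNset.
- by [].
- apply: aeW => x n _; rewrite patchE; case: ifPn => _.
    by rewrite gee0_abs.
  by rewrite abse0.
move=> _ _; rewrite integral0 => /fine_cvgP[fin /cvgrPdist_lt/(_ e e0) H].
have [n [finn Hn]] := filter_ex (filterI fin H).
exists n; rewrite integral_mkcond -[X in (X < _)%E]fineK// lte_fin.
by move: Hn; rewrite sub0r normrN; apply: le_lt_trans; exact: ler_norm.
Qed.

End SquareIntegrable.

Section Dense.
Local Open Scope complex_scope.
Local Open Scope ereal_scope.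
Context d (X : measurableType d) (R : realType).
Variable mu : {sigma_finite_measure set X -> \bar R}.

(** Members of the domain vanish almost everywhere on [{K = +oo}], so if that
    set had positive measure, the indicator of a part of it of finite measure
    would stay at a distance at least its own norm. Conversely, the truncations
    of [f] to [{K <= n}] are in the domain and converge to [f]. *)
Lemma dense_weighted_L2P (K : X -> \bar R) : measurable_fun setT K ->
  (forall x, 0 <= K x) ->
  dense_in_L2 mu [set f | L2 mu f /\
    \int[mu]_x (K x * (sqmod (f x))%:E) < +oo] <->
  {ae mu, forall x, K x < +oo}.
Proof.
move=> mK K0; split.
- move=> dK.
  pose D := K @^-1` [set +oo].
  have mD : measurable D.
    by rewrite -[D]setTI; exact: (mK measurableT _ (emeasurable_set1 _)).
  have [A UA mA] := sigma_finiteT mu.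
  suff DA n : mu (D `&` A n) = 0.
    apply: (@negligibleS _ _ _ _ (\bigcup_n (D `&` A n))).
      move=> x/= nK; have : (\bigcup_n A n) x by rewrite -UA.
      move=> [n _ Anx]; exists n => //; split => //.
      by apply: contrapT => Dx; apply: nK; rewrite ltey; apply/eqP.
    apply: negligible_bigcup => n; apply/negligibleP; last exact: DA.
    by apply: measurableI => //; have [] := mA n.
  have [mAn An] := mA n.
  set C := D `&` A n.
  have mC : measurable C by exact: measurableI.
  have Cfin : mu C \is a fin_num.
    rewrite ge0_fin_numE//; apply: le_lt_trans An.
    by apply: le_measure; rewrite ?inE//; apply: subIsetr.
  apply/eqP/negPn/negP => C0.
  have C_gt0 : (0 < fine (mu C))%R.
    by rewrite fine_gt0// lt0e C0 measure_ge0 ltey_eq Cfin.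
  pose f : X -> R[i] := cut C (fun=> 1%R).
  have nf : norm2 mu f = mu C.
    rewrite norm2_cut//.
    under eq_integral do rewrite -[1%R]/((1%R : R)%:C) sqmod_real expr1n.
    by rewrite integral_cst// mul1e.
  have f2 : L2 mu f.
    split; first by apply: cmeasurable_cut => //; exact: cmeasurable_cst.
    by rewrite nf ltey_eq Cfin.
  have [g [g2 Kg]] := dK f f2 (fine (mu C)) C_gt0.
  rewrite fineK//; apply/negP; rewrite -leNgt -nf.
  have [mg _] := g2; have [mf _] := f2.
  have g0 : {ae mu, forall x, K x = +oo -> g x = 0%R}.
    have : mu.-integrable setT (fun x => K x * (sqmod (g x))%:E).
      apply/integrableP; split.
        by apply: emeasurable_funM => //; exact: emeasurable_sqmod.
      under eq_integral do
        rewrite gee0_abs ?mule_ge0// ?lee_fin ?sqmod_ge0//.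
      exact: Kg.
    move/(integrable_ae measurableT); apply: filterS => x /(_ I) H Kx.
    apply/eqP; rewrite -sqmod_eq0; apply/negPn/negP => gx0.
    move: H; rewrite Kx gt0_mulye// lte_fin lt0r gx0; exact: sqmod_ge0.
  rewrite -[leRHS]mul1e; apply: norm2_le => //; first exact: cmeasurableB.
  move: g0; apply: filterS => x gx; rewrite mul1r.
  have [Cx|nCx] := boolP (x \in C).
    rewrite gx ?subr0//; by move: Cx; rewrite inE => -[].
  by rewrite /f cutE (negbTE nCx) sqmod0 sqmod_ge0.
- move=> Koo f f2 e e0; have [mf foo] := f2.
  pose E (n : nat) := [set x | n%:R%:E < K x].
  have mE n : measurable (E n).
    by rewrite -[E n]setTI; exact: emeasurable_fun_o_infty.
  have [n Hn] : exists n, \int[mu]_(x in E n) (sqmod (f x))%:E < e%:E.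
    apply: (@tail_integral _ _ _ mu) => //.
    - exact: emeasurable_sqmod.
    - by move=> x; rewrite lee_fin sqmod_ge0.
    move: Koo; apply: filterS => x Kx.
    have Kf : K x \is a fin_num by rewrite ge0_fin_numE.
    exists (Num.truncn (fine (K x))).+1 => // m /= Hm; apply/negP.
    rewrite -leNgt -(fineK Kf) lee_fin.
    apply: (le_trans (ltW (truncnS_gt _))); rewrite ler_nat//.
  have mnE : measurable (~` E n) by exact: measurableC.
  exists (cut (~` E n) f).
    split; first exact: L2_cut.
    apply: (@le_lt_trans _ _ (\int[mu]_x (n%:R%:E * (sqmod (f x))%:E))).
      apply: ge0_le_integral => //.
      - by move=> x _; rewrite mule_ge0// lee_fin sqmod_ge0.
      - apply: emeasurable_funM => //.
        exact/emeasurable_sqmod/cmeasurable_cut.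
      - apply: emeasurable_funM => //.
        exact/emeasurable_sqmod.
      - move=> x _; rewrite cutE; case: ifPn => xE.
          apply: lee_wpmul2r; first by rewrite lee_fin sqmod_ge0.
          by move: xE; rewrite inE/= => /negP; rewrite -leNgt.
        by rewrite sqmod0 mule0 mule_ge0// lee_fin// sqmod_ge0.
    rewrite ge0_integralZl//; last 2 first.
    - exact: emeasurable_sqmod.
    - by move=> x _; rewrite lee_fin sqmod_ge0.
    exact: lte_mul_pinfty.
  rewrite (_ : (fun x => _) = cut (E n) f) ?norm2_cut//.
  apply/funext => x; rewrite !cutE in_setC.
  by case: (x \in E n); rewrite /= ?subr0 ?subrr.
Qed.

End Dense.

(** * The inner product *)

Section Dot.
Local Open Scope complex_scope.
Context d (X : measurableType d) (R : realType).
Variable mu : {measure set X -> \bar R}.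
Implicit Types (f g : X -> R[i]).

Lemma ReMconj_le (z w : R[i]) :
  `|complex.Re (z * conjc w)| <= sqmod z + sqmod w.
Proof.
case: z w => [a b] [a' b']; rewrite /sqmod /= ler_norml.
apply/andP; split; rewrite -subr_ge0.
  rewrite (_ : _ - _ = ((a + a') ^+ 2 + (b + b') ^+ 2 +
    (a ^+ 2 + b ^+ 2 + a' ^+ 2 + b' ^+ 2)) / 2); last by field.
  by rewrite divr_ge0// !addr_ge0// sqr_ge0.
rewrite (_ : _ - _ = ((a - a') ^+ 2 + (b - b') ^+ 2 +
  (a ^+ 2 + b ^+ 2 + a' ^+ 2 + b' ^+ 2)) / 2); last by field.
by rewrite divr_ge0// !addr_ge0// sqr_ge0.
Qed.

Lemma ImMconj_le (z w : R[i]) :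
  `|complex.Im (z * conjc w)| <= sqmod z + sqmod w.
Proof.
(* multiplying [w] by [i] turns the imaginary part into the real part *)
have := ReMconj_le z ('i * w).
rewrite sqmodM (_ : sqmod 'i = 1) ?mul1r; last first.
  by rewrite /sqmod/= expr0n expr1n add0r.
case: z w => [a b] [a' b'] /=.
by rewrite (_ : a * (0 * a' - 1 * b') - b * - (0 * b' + 1 * a') =
  a * - b' + b * a')//; ring.
Qed.

Lemma L2_integrable (q : X -> R) f g : measurable_fun setT q ->
  L2 mu f -> L2 mu g -> (forall x, `|q x| <= sqmod (f x) + sqmod (g x)) ->
  mu.-integrable setT (EFin \o q).
Proof.
move=> mq [mf f2] [mg g2] qfg.
have sq0 h x : (0 <= (sqmod (h x : R[i]))%:E)%E by rewrite lee_fin sqmod_ge0.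
have I h : cmeasurable h -> (norm2 mu h < +oo)%E ->
    mu.-integrable setT (fun x => (sqmod (h x))%:E).
  move=> mh h2; apply/integrableP; split; first exact: emeasurable_sqmod.
  by under eq_integral do rewrite gee0_abs//.
apply: (le_integrable measurableT _ _
  (integrableD measurableT (I f mf f2) (I g mg g2))).
  exact/measurable_EFinP.
by move=> x _ /=; rewrite lee_fin (le_trans (qfg x))// ler_norm.
Qed.

Lemma measurable_ReMconj f g : cmeasurable f -> cmeasurable g ->
  measurable_fun setT (fun x => complex.Re (f x * conjc (g x))).
Proof. by move=> mf mg; case: (cmeasurableM mf (cmeasurable_conj mg)). Qed.

Lemma measurable_ImMconj f g : cmeasurable f -> cmeasurable g ->
  measurable_fun setT (fun x => complex.Im (f x * conjc (g x))).
Proof. by move=> mf mg; case: (cmeasurableM mf (cmeasurable_conj mg)). Qed.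

Lemma integrable_Redot f g : L2 mu f -> L2 mu g ->
  mu.-integrable setT (EFin \o (fun x => complex.Re (f x * conjc (g x)))).
Proof.
move=> f2 g2; apply: (L2_integrable _ f2 g2).
  2: by move=> x; exact: ReMconj_le.
by apply: measurable_ReMconj; [case: f2|case: g2].
Qed.

Lemma integrable_Imdot f g : L2 mu f -> L2 mu g ->
  mu.-integrable setT (EFin \o (fun x => complex.Im (f x * conjc (g x)))).
Proof.
move=> f2 g2; apply: (L2_integrable _ f2 g2).
  2: by move=> x; exact: ImMconj_le.
by apply: measurable_ImMconj; [case: f2|case: g2].
Qed.

Lemma eq_dot f g f' g' : (forall x, f x * conjc (g x) = f' x * conjc (g' x)) ->
  dot mu f g = dot mu f' g'.
Proof.
move=> E; rewrite /dot; under eq_fun do rewrite E.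
by under [in X in _ +i* X]eq_fun do rewrite E.
Qed.

Lemma ae_eq_dot f g f' g' : cmeasurable f -> cmeasurable g ->
  cmeasurable f' -> cmeasurable g' -> eqL2 mu f f' -> eqL2 mu g g' ->
  dot mu f g = dot mu f' g'.
Proof.
move=> mf mg mf' mg' ff' gg'; congr (_ +i* _); congr fine;
  apply: ae_eq_integral => //.
- exact/measurable_EFinP/measurable_ReMconj.
- exact/measurable_EFinP/measurable_ReMconj.
- by move: ff' gg'; apply: filterS2 => x -> ->.
- exact/measurable_EFinP/measurable_ImMconj.
- exact/measurable_EFinP/measurable_ImMconj.
- by move: ff' gg'; apply: filterS2 => x -> ->.
Qed.

Lemma dotDr f g h : L2 mu f -> L2 mu g -> L2 mu h ->
  dot mu f (fun x => g x + h x) = dot mu f g + dot mu f h.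
Proof.
move=> f2 g2 h2; rewrite /dot.
have E x : f x * conjc (g x + h x) = f x * conjc (g x) + f x * conjc (h x).
  by rewrite conjcD mulrDr.
have ReD (z w : R[i]) : complex.Re (z + w) = complex.Re z + complex.Re w.
  by case: z w => [? ?] [].
have ImD (z w : R[i]) : complex.Im (z + w) = complex.Im z + complex.Im w.
  by case: z w => [? ?] [].
under eq_fun do rewrite E ReD.
under [in X in _ +i* X]eq_fun do rewrite E ImD.
rewrite !RintegralD//=; first exact: integrable_Imdot;
  first exact: integrable_Imdot.
all: exact: integrable_Redot.
Qed.

Lemma dotNr f g : L2 mu f -> L2 mu g ->
  dot mu f (fun x => - g x) = - dot mu f g.
Proof.
move=> f2 g2; apply/eqP; rewrite -addr_eq0 -dotDr//; last first.
  by have := L2Zl (-1) g2; under eq_fun do rewrite mulN1r.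
rewrite /dot.
under eq_fun do rewrite addNr conjc0 mulr0.
under [in X in _ +i* X]eq_fun do rewrite addNr conjc0 mulr0.
by rewrite /Rintegral /= !integral0 eq_complex/= eqxx.
Qed.

Lemma dotBr f g h : L2 mu f -> L2 mu g -> L2 mu h ->
  dot mu f (fun x => g x - h x) = dot mu f g - dot mu f h.
Proof.
move=> f2 g2 h2; rewrite dotDr ?dotNr//.
by have := L2Zl (-1) h2; under eq_fun do rewrite mulN1r.
Qed.

Lemma dotff f : L2 mu f -> dot mu f f = (fine (norm2 mu f))%:C.
Proof.
move=> [mf f2]; rewrite /dot.
have E x : f x * conjc (f x) = (sqmod (f x))%:C.
  by case: (f x) => [a b]; rewrite /sqmod /=; apply/eqP; rewrite eq_complex/=;
    apply/andP; split; apply/eqP; ring.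
under eq_fun do rewrite E /=.
under [in X in _ +i* X]eq_fun do rewrite E /=.
by rewrite /Rintegral integral0.
Qed.

Lemma dot_bound f g e : L2 mu f -> L2 mu g ->
  (norm2 mu f + norm2 mu g <= e%:E)%E ->
  `|complex.Re (dot mu f g)| <= e /\ `|complex.Im (dot mu f g)| <= e.
Proof.
move=> f2 g2 fge; have [mf _] := f2; have [mg _] := g2.
have main (q : X -> R) : mu.-integrable setT (EFin \o q) ->
    (forall x, `|q x| <= sqmod (f x) + sqmod (g x)) ->
    `|Rintegral mu setT q| <= e.
  move=> qi qfg; rewrite -lee_fin EFin_normr_Rintegral//.
  have mq := measurable_int _ qi.
  apply: (le_trans (le_abse_integral _ _ mq)) => //.
  apply: le_trans fge; rewrite /norm2 -ge0_integralD//; last 4 first.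
  - by move=> x _; rewrite lee_fin sqmod_ge0.
  - exact: emeasurable_sqmod.
  - by move=> x _; rewrite lee_fin sqmod_ge0.
  - exact: emeasurable_sqmod.
  apply: ge0_le_integral => //.
  - exact: measurableT_comp.
  - by apply: emeasurable_funD; exact: emeasurable_sqmod.
  - by move=> x _; rewrite /= -EFinD lee_fin.
split; apply: main; last by move=> x; exact: ImMconj_le.
- exact: integrable_Redot.
- by move=> x; exact: ReMconj_le.
- exact: integrable_Imdot.
Qed.

(** Expand the square: the cross term is [2 a Re <e, f> >= 0]. With [e = P f]
    for a positive operator [P], it says that [P + a] is bounded below by [a]. *)
Lemma norm2_shift_ge (a : R) e f : 0 <= a -> L2 mu e -> L2 mu f ->
  0 <= complex.Re (dot mu e f) ->
  ((a ^+ 2)%:E * norm2 mu f <= norm2 mu (fun x => e x + a%:C * f x)%R)%E.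
Proof.
move=> a0 e2 f2 ef0; have [me _] := e2; have [mf _] := f2.
have af2 : L2 mu (fun x => e x + a%:C * f x) by apply: L2D => //; exact: L2Zl.
have norm2E g : L2 mu g ->
    norm2 mu g = (Rintegral mu setT (fun x => sqmod (g x)))%:E.
  move=> [mg g2]; rewrite /Rintegral fineK// ge0_fin_numE//; exact: norm2_ge0.
have Isq g : L2 mu g -> mu.-integrable setT (EFin \o (fun x => sqmod (g x))).
  move=> g2; apply: (L2_integrable _ g2 g2).
    by apply: measurable_sqmod; case: g2.
  by move=> x; rewrite ger0_norm ?sqmod_ge0// lerDl sqmod_ge0.
rewrite !norm2E// -EFinM lee_fin.
have E x : sqmod (e x + a%:C * f x) = sqmod (e x) +
    (2 * a * complex.Re (e x * conjc (f x)) + a ^+ 2 * sqmod (f x)).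
  by case: (e x) (f x) => [b c] [b' c']; rewrite /sqmod/=; ring.
under [leRHS]eq_Rintegral do rewrite E.
have IR : mu.-integrable setT
    (EFin \o (fun x => 2 * a * complex.Re (e x * conjc (f x)))).
  rewrite (_ : _ \o _ =
    fun x => ((2 * a)%:E * (complex.Re (e x * conjc (f x)))%:E)%E)//.
  by apply: integrableZl => //; exact: integrable_Redot.
have If : mu.-integrable setT (EFin \o (fun x => a ^+ 2 * sqmod (f x))).
  rewrite (_ : _ \o _ = fun x => ((a ^+ 2)%:E * (sqmod (f x))%:E)%E)//.
  by apply: integrableZl => //; exact: Isq.
have IRf : mu.-integrable setT (EFin \o (fun x =>
    2 * a * complex.Re (e x * conjc (f x)) + a ^+ 2 * sqmod (f x))).
  rewrite (_ : _ \o _ =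
    ((EFin \o (fun x => (2 * a * complex.Re (e x * conjc (f x)))%R)) \+
    (EFin \o (fun x => (a ^+ 2 * sqmod (f x))%R)))%E)//.
  exact: integrableD.
rewrite (RintegralD _ (Isq _ e2) IRf)// (RintegralD _ IR If)//.
rewrite (RintegralZl _ _ (Isq _ f2))//.
rewrite (RintegralZl _ _ (integrable_Redot e2 f2))//.
rewrite addrA lerDr addr_ge0//.
  by apply: Rintegral_ge0 => x _; exact: sqmod_ge0.
by rewrite mulr_ge0// mulr_ge0.
Qed.

End Dot.

(** * Operators given by their graphs *)

Section OperatorFacts.
Local Open Scope complex_scope.
Context d (X : measurableType d) (R : realType).
Variables (mu : {measure set X -> \bar R}) (T : operator X R).
Hypothesis opT : is_operator mu T.

Lemma operator_L2 f g : T f g -> L2 mu f /\ L2 mu g.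
Proof. by case: opT => H _ _ _ _; exact: H. Qed.

Lemma operator_eqL2 f g f' g' : T f g -> cmeasurable f' -> cmeasurable g' ->
  eqL2 mu f f' -> eqL2 mu g g' -> T f' g'.
Proof. by case: opT => _ H _ _ _; exact: H. Qed.

Lemma operator_lin (a : R[i]) f f' g g' : T f g -> T f' g' ->
  T (fun x => a * f x + f' x) (fun x => a * g x + g' x).
Proof. by case: opT => _ _ _ H _; exact: H. Qed.

Lemma operatorD f f' g g' : T f g -> T f' g' ->
  T (fun x => f x + f' x) (fun x => g x + g' x).
Proof.
move=> Tf Tf'; have := operator_lin 1 Tf Tf'.
by under eq_fun do rewrite mul1r;
  under [X in T _ X -> _]eq_fun do rewrite mul1r.
Qed.

Lemma operatorB f f' g g' : T f g -> T f' g' ->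
  T (fun x => f x - f' x) (fun x => g x - g' x).
Proof.
move=> Tf Tf'; have := operator_lin (-1) Tf' Tf.
by under eq_fun do rewrite mulN1r addrC;
  under [X in T _ X -> _]eq_fun do rewrite mulN1r addrC.
Qed.

Lemma operator_fun f g g' : T f g -> T f g' -> eqL2 mu g g'.
Proof. by case: opT => _ _ _ _ H; exact: H. Qed.

End OperatorFacts.

(** * Uniqueness of the positive square root *)

Section Modulus.
Local Open Scope complex_scope.
Context d (X : measurableType d) (R : realType).
Variable mu : {measure set X -> \bar R}.
Variables (s : X -> R) (P : operator X R).
Hypotheses (ms : measurable_fun setT s) (s0 : forall x, 0 <= s x).
Hypothesis saP : positive_selfadjoint mu P.
Hypothesis P2 : forall n f, L2 mu f -> (forall x, f x != 0 -> s x < n%:R) ->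
  comp_op P P f (fun x => (s x ^+ 2)%:C * f x).

Let opP : is_operator mu P. Proof. by case: saP. Qed.

Let ms2 : measurable_fun setT (fun x => s x ^+ 2).
Proof. exact: measurable_funX. Qed.

(** Put [a = (k + 1) / m] and [d = (P - a) f]. Then [(P + a) d = (s^2 - a^2)
    f], of norm at most [(2 a / m) |f|] as [s] is within [1 / m] of [a],
    whereas [|(P + a) d| >= a |d|] by positivity. So [|P f - a f| <= (2 / m)
    |f|], and [|a f - s f| <= (1 / m) |f|]; the constant is [10 = 2 * 4 + 2 *
    1]. *)
Lemma modulus_slice (n k m : nat) f g : (0 < m)%N ->
  L2 mu f -> (forall x, f x != 0 -> s x < n%:R) ->
  (forall x, f x != 0 -> k%:R / m%:R <= s x < k.+1%:R / m%:R) -> P f g ->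
  (norm2 mu (fun x => (g x - (s x)%:C * f x)%R) <=
   (10 / m%:R ^+ 2)%:E * norm2 mu f)%E.
Proof.
move=> m0 f2 fn fk Pf; have [mf _] := f2.
have m0R : 0 < m%:R :> R by rewrite ltr0n.
have [g' Pfg' Pg'] := P2 f2 fn.
have gg' := operator_fun opP Pf Pfg'.
have [_ g2] := operator_L2 opP Pf; have [mg _] := g2.
have [g'2 h2] := operator_L2 opP Pg'; have [mg' _] := g'2.
set a : R := k.+1%:R / m%:R.
have a0 : 0 < a by rewrite divr_gt0// ltr0n.
pose D x := - a%:C * f x + g' x.
pose E x := - a%:C * g' x + (s x ^+ 2)%:C * f x.
have PDE : P D E by exact: (operator_lin opP (- a%:C) Pfg' Pg').
have [D2 E2] := operator_L2 opP PDE; have [mD _] := D2.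
have ED0 : 0 <= complex.Re (dot mu E D).
  by have [_ _ _ /(_ _ _ PDE)] := saP; rewrite lecE => /andP[].
have := norm2_shift_ge (ltW a0) E2 D2 ED0.
have shiftE : (fun x => E x + a%:C * D x) =
    (fun x => (s x ^+ 2 - a ^+ 2)%:C * f x).
  apply/funext => x; rewrite /E /D.
  rewrite rmorphB/= rmorphXn/=.
  by rewrite [X in _ - X](_ : _ = a%:C ^+ 2) ?rmorphXn//; ring.
rewrite shiftE => lower.
have aE : a = k%:R / m%:R + m%:R^-1 by rewrite /a -natr1 mulrDl mul1r.
have near_a x : f x != 0 -> 0 <= a - s x <= m%:R^-1.
  move=> /fk/andP[ks sk]; rewrite subr_ge0 (ltW sk)/=.
  by rewrite lerBlDl aE lerD2r.
have upper : (norm2 mu (fun x => ((s x ^+ 2 - a ^+ 2)%:C * f x)%R) <=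
    ((2 * a / m%:R) ^+ 2)%:E * norm2 mu f)%E.
  apply: norm2_le; first exact: sqr_ge0.
  - by apply: cmeasurableZ => //; apply: measurable_funB.
  - exact: mf.
  apply: aeW => x; have [->|fx0] := eqVneq (f x) 0.
    by rewrite mulr0 sqmod0 mulr0.
  rewrite sqmodZ ler_wpM2r ?sqmod_ge0//.
  have /andP[l u] := near_a x fx0.
  rewrite (_ : s x ^+ 2 - a ^+ 2 = - ((s x + a) * (a - s x))); last by ring.
  rewrite sqrrN lerXn2r ?nnegrE//.
  - by rewrite mulr_ge0// addr_ge0// ltW.
  - by rewrite divr_ge0 ?mulr_ge0// ltW.
  - apply: ler_pM => //; first by rewrite addr_ge0// ltW.
    by rewrite mulrDl mul1r lerD2r -subr_ge0.
have nD : (norm2 mu D <= (4 / m%:R ^+ 2)%:E * norm2 mu f)%E.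
  rewrite -(@lee_pmul2l _ (a ^+ 2)%:E)//; last by rewrite lte_fin exprn_gt0.
  apply: (le_trans lower); apply: (le_trans upper).
  rewrite muleA -EFinM (_ : (2 * a / m%:R) ^+ 2 = a ^+ 2 * (4 / m%:R ^+ 2))//.
  by field; rewrite gt_eqF.
have nA : (norm2 mu (fun x => ((a - s x)%:C * f x)%R) <=
    (m%:R ^- 2)%:E * norm2 mu f)%E.
  apply: norm2_le; first by rewrite invr_ge0 sqr_ge0.
  - by apply: cmeasurableZ => //; apply: measurable_funB.
  - exact: mf.
  apply: aeW => x; have [->|fx0] := eqVneq (f x) 0.
    by rewrite mulr0 sqmod0 mulr0.
  rewrite sqmodZ ler_wpM2r ?sqmod_ge0//.
  have /andP[l u] := near_a x fx0.
  by rewrite -exprVn lerXn2r// nnegrE invr_ge0 ltW.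
have mA : cmeasurable (fun x => (a - s x)%:C * f x).
  by apply: cmeasurableZ => //; apply: measurable_funB.
rewrite (@eqL2_norm2 _ _ _ mu _ (fun x => D x + (a - s x)%:C * f x)).
- apply: (le_trans (norm2D_le mu mD mA)).
  apply: (@le_trans _ _ (2%:E * ((4 / m%:R ^+ 2)%:E * norm2 mu f) +
      2%:E * ((m%:R ^- 2)%:E * norm2 mu f))%E).
    by apply: leeD; apply: lee_wpmul2l.
  rewrite !muleA -!EFinM -ge0_muleDl ?lee_fin; last 2 first.
  - by rewrite mulr_ge0// divr_ge0// sqr_ge0.
  - by rewrite mulr_ge0// invr_ge0 sqr_ge0.
  by rewrite -EFinD (_ : _ + _ = 10 / m%:R ^+ 2)//; ring.
- by apply: cmeasurableB => //; exact: cmeasurableZ.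
- by apply: cmeasurableD.
- move: gg'; apply: filterS => x ->; rewrite /D rmorphB/=; ring.
Qed.

(** Cut [f] into the [n m] slices [{k / m <= s < (k + 1) / m}]. Summing [n m]
    errors of squared norm at most [(10 / m^2) |f_k|^2] costs a factor [n m +
    1], so [|P f - s f|^2] is of order [n / m], for every [m]. The slices need
    not be known to be orthogonal after applying [P], so no commutation of [P]
    with multiplication operators is involved. *)
Lemma modulus_bounded_support (n : nat) f :
  L2 mu f -> (forall x, f x != 0 -> s x < n%:R) ->
  P f (fun x => (s x)%:C * f x).
Proof.
move=> f2 fn; have [mf foo] := f2.
have mlt (c : R) : measurable [set x | s x < c].
  rewrite -[X in measurable X]setTI.
  rewrite (_ : [set x | s x < c] = s @^-1` `]-oo, c[); first exact: ms.
  by apply/seteqP; split => x /=; rewrite in_itv.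
have memlt c x : (x \in [set y | s y < c]) = (s x < c).
  by apply/idP/idP; rewrite inE.
pose F m K := cut [set x | s x < K%:R / m%:R] f.
(* the factor [K + 1] rather than [K] keeps the weight [t = K + 1] positive in
   the step from [K = 0] *)
have slices m K : (0 < m)%N -> exists G, P (F m K) G /\
    (norm2 mu (fun x => (G x - (s x)%:C * F m K x)%R) <=
     (K.+1%:R * (10 / m%:R ^+ 2))%:E * norm2 mu (F m K))%E.
  move=> m0; have m0R : 0 < m%:R :> R by rewrite ltr0n.
  elim: K => [|K [G [PG nG]]].
    have F0 : F m 0 = fun=> 0.
      apply/funext => x; rewrite /F cutE mul0r memNset//=.
      by apply/negP; rewrite -leNgt.
    exists (fun=> 0); split; first by rewrite F0; case: opP.
    rewrite F0 (_ : norm2 _ _ = 0%E).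
      by rewrite mule_ge0 ?norm2_ge0// lee_fin mulr_ge0// divr_ge0// sqr_ge0.
    apply/norm2_eq0; last by apply: aeW => x; rewrite mulr0 subr0.
    under eq_fun do rewrite mulr0 subr0; exact: cmeasurable_cst.
  pose S := [set x | s x < K.+1%:R / m%:R] `\` [set x | s x < K%:R / m%:R].
  have mS : measurable S by exact: measurableD.
  pose fS := cut S f.
  have fS2 : L2 mu fS by exact: L2_cut.
  have fS0 x : fS x != 0 -> S x /\ f x != 0.
    rewrite /fS cutE; case: ifPn => [|_]; last by rewrite eqxx.
    by rewrite inE.
  have [g Pg _] : comp_op P P fS (fun x => (s x ^+ 2)%:C * fS x).
    by apply: (@P2 n) => // x /fS0[_]; exact: fn.
  have FS x : F m K.+1 x = F m K x + fS x.
    rewrite /F /fS !cutE /S in_setD !memlt.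
    case: (ltP (s x) (K%:R / m%:R)) => h; rewrite ?andbF ?andbT ?addr0 ?add0r//.
    by rewrite (lt_trans h)// ltr_pM2r ?invr_gt0// ltr_nat.
  have PF : P (F m K.+1) (fun x => G x + g x).
    have -> : F m K.+1 = (fun x => F m K x + fS x) by exact/funext.
    exact: (operatorD opP).
  exists (fun x => G x + g x); split => //.
  have [FK2 G2] := operator_L2 opP PG; have [mG _] := G2.
  have [_ g2] := operator_L2 opP Pg; have [mg _] := g2.
  have [mFK _] := FK2; have [mfS _] := fS2.
  have ng := @modulus_slice n K m fS g m0 fS2
    (fun x h => fn x (fS0 x h).2) _ Pg.
  have {}ng : (norm2 mu (fun x => (g x - (s x)%:C * fS x)%R) <=
      (10 / m%:R ^+ 2)%:E * norm2 mu fS)%E.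
    apply: ng => x /fS0[[/= l /negP]]; rewrite -leNgt => u _.
    by rewrite l u.
  rewrite (_ : (fun x => _) = fun x => (G x - (s x)%:C * F m K x) +
    (g x - (s x)%:C * fS x)); last first.
    by apply/funext => x; rewrite FS; ring.
  have nadd : norm2 mu (F m K.+1) = (norm2 mu (F m K) + norm2 mu fS)%E.
    rewrite /norm2 -ge0_integralD//; first last.
    - exact: emeasurable_sqmod.
    - by move=> x _; rewrite lee_fin sqmod_ge0.
    - exact: emeasurable_sqmod.
    - by move=> x _; rewrite lee_fin sqmod_ge0.
    apply: eq_integral => x _; rewrite FS -EFinD /F /fS !cutE /S in_setD.
    by case: (x \in [set x | s x < K%:R / m%:R]); case: (x \in _);
      rewrite /= ?add0r ?addr0 ?sqmod0 ?add0r ?addr0.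
  have K0 : 0 < K.+1%:R :> R by rewrite ltr0n.
  apply: (le_trans (norm2D_weighted mu K0 _ _)).
  - by apply: cmeasurableB => //; exact: cmeasurableZ.
  - by apply: cmeasurableB => //; exact: cmeasurableZ.
  set c : R := 10 / m%:R ^+ 2 in nG ng *.
  have c0 : 0 <= c by rewrite divr_ge0// sqr_ge0.
  have k1 : 0 <= 1 + K.+1%:R^-1 :> R by rewrite addr_ge0// invr_ge0 ltW.
  have k2 : 0 <= 1 + K.+1%:R :> R by rewrite addr_ge0.
  apply: (@le_trans _ _
      ((1 + K.+1%:R^-1)%:E * ((K.+1%:R * c)%:E * norm2 mu (F m K)) +
      (1 + K.+1%:R)%:E * (c%:E * norm2 mu fS))%E).
    by apply: leeD; apply: lee_wpmul2l; rewrite ?lee_fin.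
  rewrite nadd [in leRHS]ge0_muleDr ?norm2_ge0//.
  rewrite !(muleA _ _ (norm2 mu _)) -!EFinM.
  rewrite (_ : (1 + K.+1%:R^-1) * (K.+1%:R * c) = K.+2%:R * c).
    by rewrite (_ : (1 + K.+1%:R) * c = K.+2%:R * c)// -[K.+2]add1n natrD.
  rewrite mulrA mulrDl mulVf ?gt_eqF// mul1r.
  by rewrite -[K.+2]addn1 natrD.
have [g Pg _] := P2 f2 fn.
have [_ g2] := operator_L2 opP Pg; have [mg _] := g2.
have msf : cmeasurable (fun x => (s x)%:C * f x) by exact: cmeasurableZ.
have mdiff : cmeasurable (fun x => g x - (s x)%:C * f x).
  exact: cmeasurableB.
apply: (operator_eqL2 opP Pg) => //; first exact: aeW.
suff : norm2 mu (fun x => g x - (s x)%:C * f x) = 0%E.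
  move/(norm2_eq0 mu mdiff); apply: filterS => x /eqP.
  by rewrite subr_eq0 => /eqP.
have bound m : (0 < m)%N ->
    (norm2 mu (fun x => (g x - (s x)%:C * f x)%R) <=
     (10 * n.+1%:R / m%:R)%:E * norm2 mu f)%E.
  move=> m0; have m0R : 0 < m%:R :> R by rewrite ltr0n.
  have [G [PG nG]] := slices m (n * m)%N m0.
  have Ff : F m (n * m)%N = f.
    apply/funext => x; rewrite /F cutE natrM mulfK ?gt_eqF//.
    case: ifPn => //; rewrite notin_setE/= => /negP; rewrite -leNgt => nx.
    apply/esym/eqP/negPn/negP => /fn; by rewrite ltNge nx.
  rewrite Ff in PG nG.
  have Gg := operator_fun opP PG Pg.
  have [_ [mG _]] := operator_L2 opP PG.
  rewrite (@eqL2_norm2 _ _ _ mu _ (fun x => G x - (s x)%:C * f x))//.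
  - apply: (le_trans nG); apply: lee_wpmul2r; first exact: norm2_ge0.
    rewrite lee_fin -natr1 natrM -natr1 -subr_ge0.
    rewrite (_ : _ - _ = 10 * (m%:R - 1) / m%:R ^+ 2);
      last by field; rewrite gt_eqF.
    by rewrite divr_ge0 ?sqr_ge0// mulr_ge0// subr_ge0 ler1n.
  - exact: cmeasurableB.
  - by move: Gg; apply: filterS => x ->.
set y := norm2 _ _ in bound *.
have y0 : (0 <= y)%E by exact: norm2_ge0.
have ffin : norm2 mu f \is a fin_num by rewrite ge0_fin_numE// norm2_ge0.
apply/eqP; rewrite eq_le y0 andbT.
apply/lee_addgt0Pr => e e0; rewrite add0e.
set c := 10 * n.+1%:R * fine (norm2 mu f).
have := bound (Num.truncn (c / e)).+1 isT.
move/le_trans; apply; rewrite -(fineK ffin) -EFinM lee_fin.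
rewrite mulrAC ler_pdivrMr ?ltr0n// -/c -ler_pdivrMl// [_ * c]mulrC.
exact/ltW/truncnS_gt.
Qed.

(** Self-adjointness extends the identity from functions supported in a set [{s
    < n}] to the whole domain, in both directions. If [P f = g], pairing with
    [u = g - s f] cut to [{s < n}], on which [P] is known, gives [|u|^2 = 0].
    Conversely, if [f] and [s f] are in [L^2], then [<P u, f> = <u, s f>] holds
    for the truncations of [f], hence for [f] by dominated convergence, so [f]
    is in the domain of [P^* = P]. *)
Theorem modulus_multiplication f g :
  P f g <-> [/\ L2 mu f, L2 mu g & eqL2 mu g (fun x => (s x)%:C * f x)].
Proof.
have [_ _ adjP _] := saP.
pose B (n : nat) := [set x | s x < n%:R].
have mB n : measurable (B n).
  rewrite -[B n]setTI.
  rewrite (_ : B n = s @^-1` `]-oo, n%:R[); first exact: ms.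
  by apply/seteqP; split => x /=; rewrite in_itv.
have cutB n (h : X -> R[i]) x : cut (B n) h x != 0 -> s x < n%:R.
  rewrite cutE; case: ifPn => [|_]; last by rewrite eqxx.
  by rewrite inE.
have PB n h : L2 mu h -> P (cut (B n) h) (fun x => (s x)%:C * cut (B n) h x).
  move=> h2; apply: (@modulus_bounded_support n); first exact: L2_cut.
  by move=> x; exact: cutB.
split=> [Pf|[f2 g2 gsf]].
- have [f2 g2] := operator_L2 opP Pf; split => //.
  have [mf _] := f2; have [mg _] := g2.
  have msf : cmeasurable (fun x => (s x)%:C * f x) by exact: cmeasurableZ.
  have Bn n : {ae mu, forall x, B n x -> g x = (s x)%:C * f x}.
    have sf2 : L2 mu (fun x => (s x)%:C * cut (B n) f x).
      by have [] := operator_L2 opP (PB n _ f2).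
    pose u := fun x => cut (B n) g x - (s x)%:C * cut (B n) f x.
    have u2 : L2 mu u by apply: L2B => //; exact: L2_cut.
    have uE : u = cut (B n) u.
      apply/funext => x; rewrite /u !cutE; case: ifPn => //.
      by rewrite mulr0 subr0.
    have := PB n _ u2; rewrite -uE => Pu.
    have /adjP[_ _ /(_ _ _ Pu) uf] := Pf.
    have : dot mu u u = 0.
      rewrite [X in dot _ _ X](_ : u =
        fun x => cut (B n) g x - (s x)%:C * cut (B n) f x)//.
      rewrite dotBr//; last exact: L2_cut.
      rewrite (@eq_dot _ _ _ mu u (cut (B n) g) u g); last first.
        move=> x; rewrite /u !cutE; case: ifPn => //.
        by rewrite mulr0 subr0 !mul0r.
      rewrite -uf; apply/eqP; rewrite subr_eq0; apply/eqP.
      apply: eq_dot => x; rewrite /u !cutE; case: ifPn => _.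
        by rewrite conjcZ mulrCA mulrA.
      by rewrite !mulr0 subr0 mulr0 !mul0r.
    rewrite dotff// => /(congr1 (@complex.Re R)) /= nu.
    have mu' : cmeasurable u by case: u2.
    have : norm2 mu u = 0%E.
      have [_ uoo] := u2.
      by rewrite -(@fineK _ (norm2 mu u)) ?nu// ge0_fin_numE// norm2_ge0.
    move/(norm2_eq0 mu mu'); apply: filterS => x; rewrite /u !cutE => + Bx.
    by rewrite mem_set// => /eqP; rewrite subr_eq0 => /eqP.
  apply: (@negligibleS _ _ _ _
    (\bigcup_n ~` [set x | B n x -> g x = (s x)%:C * f x])).
    move=> x /= nx; exists (Num.truncn (s x)).+1 => //= H; apply: nx; apply: H.
    exact: truncnS_gt.
  exact: negligible_bigcup.
- have [mf _] := f2; have [mg _] := g2.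
  have mf_ : cmeasurable (fun x => (s x)%:C * f x) by exact: cmeasurableZ.
  have sf2 : L2 mu (fun x => (s x)%:C * f x).
    by apply: eqL2_L2 g2 mf_ _; move: gsf; apply: filterS => x ->.
  apply: (@operator_eqL2 _ _ _ _ _ opP f (fun x => (s x)%:C * f x)) => //.
    2: exact: aeW.
    2: by move: gsf; apply: filterS => x ->.
  apply/adjP; split => // u v Puv.
  have [u2 v2] := operator_L2 opP Puv.
  have [mu_ uoo] := u2; have [mv voo] := v2; have [_ foo] := f2.
  have [_ sfoo] := sf2.
  pose q x := ((sqmod (v x))%:E + (sqmod (f x))%:E +
    ((sqmod (u x))%:E + (sqmod ((s x)%:C * f x))%:E))%E.
  have sq0 (h : X -> R[i]) x : (0 <= (sqmod (h x))%:E)%E.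
    by rewrite lee_fin sqmod_ge0.
  have mq : measurable_fun setT q.
    by apply: emeasurable_funD; apply: emeasurable_funD; exact: emeasurable_sqmod.
  have q0 x : (0 <= q x)%E.
    by rewrite /q !adde_ge0// lee_fin sqmod_ge0.
  have qint D : measurable D -> (\int[mu]_(x in D) q x =
      norm2 mu (cut D v) + norm2 mu (cut D f) +
      (norm2 mu (cut D u) + norm2 mu (cut D (fun x => ((s x)%:C * f x)%R))))%E.
    move=> mD; rewrite !norm2_cut// /q.
    have mE h : cmeasurable h ->
        measurable_fun D (fun x => (sqmod (h x : R[i]))%:E).
      by move=> mh; apply: measurable_funTS; exact: emeasurable_sqmod.
    rewrite ge0_integralD//; first last.
    - by apply: emeasurable_funD; exact: mE.
    - by move=> x _; rewrite adde_ge0// lee_fin sqmod_ge0.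
    - by apply: emeasurable_funD; exact: mE.
    - by move=> x _; rewrite adde_ge0.
    congr (_ + _)%E; rewrite ge0_integralD//; try exact: mE.
    by move=> x _; rewrite lee_fin sqmod_ge0.
  have qoo : (\int[mu]_x q x < +oo)%E.
    rewrite qint//; apply: lte_add_pinfty; apply: lte_add_pinfty.
    - by have [] := L2_cut measurableT v2.
    - by have [] := L2_cut measurableT f2.
    - by have [] := L2_cut measurableT u2.
    - by have [] := L2_cut measurableT sf2.
  pose E n := ~` B n.
  have mE n : measurable (E n) by exact: measurableC.
  have splitE n (h : X -> R[i]) : h = fun x => cut (B n) h x + cut (E n) h x.
    apply/funext => x; rewrite !cutE in_setC.
    by case: (x \in B n); rewrite /= ?addr0 ?add0r.
  (* on [{s < n}] both inner products agree, only the tails remain *)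
  have zE n : dot mu v f - dot mu u (fun x => (s x)%:C * f x) =
      dot mu v (cut (E n) f) - dot mu u (cut (E n) (fun x => (s x)%:C * f x)).
    rewrite [in dot mu v f](splitE n f) dotDr//; [|exact: L2_cut|exact: L2_cut].
    rewrite [in dot mu u (fun x => (s x)%:C * f x)](splitE n
      (fun x => (s x)%:C * f x)).
    rewrite dotDr//; [|exact: L2_cut|exact: L2_cut].
    have /adjP[_ _ /(_ _ _ Puv) ->] := PB n _ f2.
    rewrite [X in dot mu u X + _ - _](_ : _ =
      cut (B n) (fun x => (s x)%:C * f x)).
      ring.
    by apply/funext => x; rewrite !cutE; case: ifPn => //; rewrite mulr0.
  have small e : 0 < e ->
      `|complex.Re (dot mu v f - dot mu u (fun x => (s x)%:C * f x))| <= e + e /\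
      `|complex.Im (dot mu v f - dot mu u (fun x => (s x)%:C * f x))| <= e + e.
    move=> e0.
    have [|n Hn] := @tail_integral _ _ _ mu q E e mq q0 qoo mE _ e0.
      apply: aeW => x; exists (Num.truncn (s x)).+1 => // m /= Hm; apply.
      rewrite /B/=; apply: (lt_le_trans (truncnS_gt _)).
      by rewrite ler_nat.
    rewrite (zE n); move/ltW : Hn; rewrite qint// => Hn.
    have [r1 i1] : `|complex.Re (dot mu v (cut (E n) f))| <= e /\
        `|complex.Im (dot mu v (cut (E n) f))| <= e.
      rewrite (@eq_dot _ _ _ mu v _ (cut (E n) v) (cut (E n) f)); last first.
        by move=> x; rewrite !cutE; case: ifPn => //; rewrite conjc0 mulr0 mul0r.
      apply: dot_bound; [exact: L2_cut|exact: L2_cut|].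
      by apply: le_trans Hn; rewrite leeDl// adde_ge0// norm2_ge0.
    have [r2 i2] :
        `|complex.Re (dot mu u (cut (E n) (fun x => (s x)%:C * f x)))| <= e /\
        `|complex.Im (dot mu u (cut (E n) (fun x => (s x)%:C * f x)))| <= e.
      rewrite (@eq_dot _ _ _ mu u _ (cut (E n) u)
        (cut (E n) (fun x => (s x)%:C * f x))); last first.
        by move=> x; rewrite !cutE; case: ifPn => //; rewrite conjc0 mulr0 mul0r.
      apply: dot_bound; [exact: L2_cut|exact: L2_cut|].
      by apply: le_trans Hn; rewrite leeDr// adde_ge0// norm2_ge0.
    move: r1 i1 r2 i2; case: (dot _ _ _) => [a b].
    case: (dot _ _ _) => [a' b'] /=.
    move=> r1 i1 r2 i2; split.
      by rewrite (le_trans (ler_normB _ _))// lerD.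
    by rewrite (le_trans (ler_normB _ _))// lerD.
  have zero (y : R) : (forall e, 0 < e -> `|y| <= e + e) -> y = 0.
    move=> H; apply/eqP; rewrite -normr_le0; apply/ler_addgt0Pr => e e0.
    rewrite add0r (le_trans (H (e / 2) _)) ?divr_gt0//.
    by rewrite -mulrDl -mulr2n -(mulr_natr e) mulfK.
  apply/eqP; rewrite -subr_eq0 eq_complex/=; apply/andP; split; apply/eqP.
  - by apply: zero => e /small[].
  - by apply: zero => e /small[].
Qed.

End Modulus.

(** * Weighted composition operators *)

Section WeightedComposition.
Local Open Scope complex_scope.
Context d (X : measurableType d) (R : realType).
Variable mu : {measure set X -> \bar R}.
Variables (phi : X -> X) (w : X -> R[i]) (h : X -> \bar R).
Hypotheses (mphi : measurable_fun setT phi) (mw : cmeasurable w)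
  (hP : is_RN mu phi w h).
Implicit Types (u v : X -> R[i]).

Definition wcomp_fun (phi : X -> X) (w u : X -> R[i]) : X -> R[i] :=
  fun x => w x * u (phi x).

Lemma cmeasurable_wcomp_fun u : cmeasurable u ->
  cmeasurable (wcomp_fun phi w u).
Proof. by move=> mu'; apply: cmeasurableM => //; exact: cmeasurable_comp. Qed.

Lemma norm2_wcomp_fun u : cmeasurable u ->
  norm2 mu (wcomp_fun phi w u) = (\int[mu]_x (h x * (sqmod (u x))%:E))%E.
Proof.
move=> mu'; rewrite -(RN_change_of_variables mphi mw hP)//.
- by apply: eq_integral => x _; rewrite sqmodM EFinM.
- exact: emeasurable_sqmod.
- by move=> x; rewrite lee_fin sqmod_ge0.
Qed.

Lemma wcompE u v : wcomp mu phi w u v ->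
  [/\ L2 mu u, L2 mu v & eqL2 mu v (wcomp_fun phi w u)].
Proof. by []. Qed.

Lemma dom_wcomp : dom (wcomp mu phi w) =
  [set u | L2 mu u /\ (\int[mu]_x (h x * (sqmod (u x))%:E) < +oo)%E].
Proof.
apply/seteqP; split => u.
  move=> [v /wcompE[u2 v2 vu]]; split => //.
  have [mu' _] := u2; rewrite -norm2_wcomp_fun//.
  have /(_ _)[]// := eqL2_L2 v2 (cmeasurable_wcomp_fun mu').
  by move: vu; apply: filterS => x ->.
move=> [u2]; have [mu' _] := u2; rewrite -norm2_wcomp_fun// => wu.
exists (wcomp_fun phi w u); split => //; last exact: aeW.
by split => //; exact: cmeasurable_wcomp_fun.
Qed.

(** Preimages of [mu]-null sets are [mu_w]-null, as [mu_w o phi^-1] has a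
    density. *)
Lemma ae_comp (Q : X -> Prop) : {ae mu, forall x, Q x} ->
  {ae mu, forall x, w x != 0 -> Q (phi x)}.
Proof.
move=> [B [mB B0 QB]].
have : {ae mu, forall x, B x -> h x = 0%E}.
  by exists B; split => // x /not_implyP[].
move/(RN_preimage_null mphi mw hP mB); rewrite ae_wmeasureP//.
apply: filterS => x nB /nB nBx; apply: contrapT => nQ; apply: nBx.
exact: QB.
Qed.

End WeightedComposition.

Section RealDensity.
Local Open Scope complex_scope.
Context d (X : measurableType d) (R : realType).
Variable mu : {measure set X -> \bar R}.
Variables (phi : X -> X) (w : X -> R[i]) (r : X -> R).
Hypotheses (mphi : measurable_fun setT phi) (mw : cmeasurable w)
  (rP : is_RN mu phi w (EFin \o r)).
Implicit Types (u v : X -> R[i]).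

Let mr : measurable_fun setT r.
Proof. by case: rP => /measurable_EFinP. Qed.

Let r0 x : 0 <= r x.
Proof. by case: rP => _ /(_ x); rewrite lee_fin. Qed.

Lemma L2_wcomp_fun_le (c : R) u v : 0 <= c -> cmeasurable u -> L2 mu v ->
  (forall x, r x * sqmod (u x) <= c * sqmod (v x)) ->
  L2 mu (wcomp_fun phi w u) /\
  (norm2 mu (wcomp_fun phi w u) <= c%:E * norm2 mu v)%E.
Proof.
move=> c0 mu' [mv v2] uv.
have le : (norm2 mu (wcomp_fun phi w u) <= c%:E * norm2 mu v)%E.
  rewrite (norm2_wcomp_fun mphi mw rP)// /norm2 -ge0_integralZl//.
  - apply: ge0_le_integral => //.
    + by move=> x _; rewrite mule_ge0// lee_fin ?sqmod_ge0// r0.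
    + apply: emeasurable_funM; last exact: emeasurable_sqmod.
      exact/measurable_EFinP.
    + by apply: emeasurable_funM => //; exact: emeasurable_sqmod.
    + by move=> x _; rewrite /= -!EFinM lee_fin.
  - exact: emeasurable_sqmod.
  - by move=> x _; rewrite lee_fin sqmod_ge0.
split => //; split; first exact: cmeasurable_wcomp_fun.
by apply: (le_lt_trans le); exact: lte_mul_pinfty.
Qed.

(** The change of variables applies to the positive and negative parts
    separately, so the equality holds whether or not [q] is integrable. *)
Lemma Rintegral_wcomp_fun (q : X -> R) : measurable_fun setT q ->
  Rintegral mu setT (fun x => sqmod (w x) * q (phi x)) =
  Rintegral mu setT (fun x => r x * q x).
Proof.
move=> mq; congr fine; rewrite integralE [RHS]integralE.
have mqE : measurable_fun setT (EFin \o q) by exact/measurable_EFinP.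
have pos (k q1 : X -> R) : (forall x, 0 <= k x) ->
    (fun x => (k x * q1 x)%:E)^\+%E = (fun x => (k x)%:E * (EFin \o q1)^\+ x)%E.
  move=> k0; apply/funext => x; rewrite !funeposE /= -!EFin_max -EFinM.
  by rewrite maxr_pMr ?mulr0.
have neg (k q1 : X -> R) : (forall x, 0 <= k x) ->
    (fun x => (k x * q1 x)%:E)^\-%E = (fun x => (k x)%:E * (EFin \o q1)^\- x)%E.
  move=> k0; apply/funext => x; rewrite !funenegE /= -!EFin_max -EFinM.
  by rewrite maxr_pMr ?mulr0 ?mulrN.
rewrite (pos (fun x => sqmod (w x)) (q \o phi)); last first.
  by move=> x; exact: sqmod_ge0.
rewrite (neg (fun x => sqmod (w x)) (q \o phi)); last first.
  by move=> x; exact: sqmod_ge0.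
rewrite pos// neg//.
congr (_ - _)%E.
- rewrite -(RN_change_of_variables mphi mw rP (f := (EFin \o q)^\+%E))//.
    by apply: eq_integral => x _; rewrite !funeposE.
  exact: measurable_funepos.
- rewrite -(RN_change_of_variables mphi mw rP (f := (EFin \o q)^\-%E))//.
    by apply: eq_integral => x _; rewrite !funenegE.
  exact: measurable_funeneg.
Qed.

Lemma dot_wcomp_fun u f : cmeasurable u -> cmeasurable f ->
  dot mu (wcomp_fun phi w u) (wcomp_fun phi w f) =
  dot mu u (fun x => (r x)%:C * f x).
Proof.
move=> mu' mf; rewrite /dot; congr (_ +i* _).
- have := Rintegral_wcomp_fun (measurable_ReMconj mu' mf).
  rewrite (_ : (fun x => r x * _) =
      fun x => complex.Re (u x * conjc ((r x)%:C * f x))); last first.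
    by apply/funext => x; case: (u x) (f x) => [a b] [a' b'] /=; ring.
  move=> <-; congr Rintegral; apply/funext => x.
  rewrite /wcomp_fun /sqmod.
  by case: (w x) (u (phi x)) (f (phi x)) => [a b] [a1 b1] [a2 b2] /=; ring.
- have := Rintegral_wcomp_fun (measurable_ImMconj mu' mf).
  rewrite (_ : (fun x => r x * _) =
      fun x => complex.Im (u x * conjc ((r x)%:C * f x))); last first.
    by apply/funext => x; case: (u x) (f x) => [a b] [a' b'] /=; ring.
  move=> <-; congr Rintegral; apply/funext => x.
  rewrite /wcomp_fun /sqmod.
  by case: (w x) (u (phi x)) (f (phi x)) => [a b] [a1 b1] [a2 b2] /=; ring.
Qed.

End RealDensity.

(** * The polar decomposition of the pair *)

Section Polar.
Local Open Scope complex_scope.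
Context d (X : measurableType d) (R : realType).
Variable mu : {measure set X -> \bar R}.
Variables (phi : 'I_2 -> X -> X) (w : 'I_2 -> X -> R[i]) (r : 'I_2 -> X -> R).
Hypotheses (mphi : forall i, measurable_fun setT (phi i))
  (mw : forall i, cmeasurable (w i))
  (rP : forall i, is_RN mu (phi i) (w i) (EFin \o r i)).
Variable s : X -> R.
Hypotheses (ms : measurable_fun setT s) (s0 : forall x, 0 <= s x)
  (sE : forall x, s x ^+ 2 = \sum_(i < 2) r i x).
Let T i := wcomp mu (phi i) (w i).
Variables (U : 'I_2 -> operator X R) (P : operator X R).
Hypothesis polar : is_polar_decomposition mu T U P.

Let mr i : measurable_fun setT (r i).
Proof. by case: (rP i) => /measurable_EFinP. Qed.

Let r0 i x : 0 <= r i x.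
Proof. by case: (rP i) => _ /(_ x); rewrite lee_fin. Qed.

Let r_le i x : r i x <= s x ^+ 2.
Proof. by rewrite sE (bigD1 i)//= lerDl sumr_ge0. Qed.

Let rs0 i x : s x = 0 -> r i x = 0.
Proof.
move=> sx; apply/eqP; rewrite eq_le r0 andbT.
by apply: (le_trans (r_le i x)); rewrite sx expr0n.
Qed.

Let ms2 : measurable_fun setT (fun x => s x ^+ 2).
Proof. exact: measurable_funX. Qed.

(** For [f] supported in [{s < n}], the change of variables gives [T^* T f =
    (r_0 + r_1) f = s^2 f], so [P^2] extends the multiplication by [s^2] on
    these functions. *)
Lemma polar_modulusE f g :
  P f g <-> [/\ L2 mu f, L2 mu g & eqL2 mu g (fun x => (s x)%:C * f x)].
Proof.
have [[saP P2] _ _ _] := polar.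
apply: modulus_multiplication => // n {}f f2 fn.
have [mf _] := f2.
have fsn x : f x != 0 -> s x ^+ 2 <= n%:R ^+ 2.
  by move=> /fn /ltW sn; rewrite lerXn2r// nnegrE// (le_trans (s0 x) sn).
have L2c (c : X -> R) : measurable_fun setT c ->
    (forall x, 0 <= c x <= s x ^+ 2) ->
    L2 mu (fun x => (c x)%:C * f x).
  move=> mc cs; apply: (@L2_le _ _ _ _ ((n%:R ^+ 2) ^+ 2) _ f) => //.
    exact: cmeasurableZ.
  apply: aeW => x; have [->|fx0] := eqVneq (f x) 0.
    by rewrite mulr0 sqmod0 mulr0.
  have /andP[c0 cle] := cs x.
  rewrite sqmodZ ler_wpM2r ?sqmod_ge0// lerXn2r ?nnegrE ?exprn_ge0//.
  exact: (le_trans cle (fsn x fx0)).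
have wf2 i : L2 mu (wcomp_fun (phi i) (w i) f).
  have [] := @L2_wcomp_fun_le _ _ _ mu (phi i) (w i) (r i)
    (mphi i) (mw i) (rP i) (n%:R ^+ 2) f f _ mf f2 _ => //.
  move=> x; have [->|fx0] := eqVneq (f x) 0; first by rewrite sqmod0 !mulr0.
  by rewrite ler_wpM2r ?sqmod_ge0// (le_trans (r_le i x))// fsn.
apply/P2; exists (fun i => wcomp_fun (phi i) (w i) f).
  by move=> i; split => //; exact: aeW.
split => //.
  by apply: L2c => // x; rewrite sqr_ge0 lexx.
move=> u v Tuv.
have u2 : L2 mu u by case: (Tuv ord0).
have [mu' _] := u2.
have dotE i : dot mu (v i) (wcomp_fun (phi i) (w i) f) =
    dot mu u (fun x => (r i x)%:C * f x).
  rewrite -(dot_wcomp_fun (mphi i) (mw i) (rP i))//.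
  have [_ [mv _] vu] := Tuv i.
  apply: ae_eq_dot => //; try exact: cmeasurable_wcomp_fun.
  exact: aeW.
under eq_bigr do rewrite dotE.
rewrite !big_ord_recl big_ord0 addr0 -dotDr//.
- apply: eq_dot => x; rewrite sE !big_ord_recl big_ord0 addr0.
  by congr (_ * conjc _); rewrite -mulrDl -rmorphD.
- by apply: L2c => // x; rewrite r0 r_le.
- by apply: L2c => // x; rewrite r0 r_le.
Qed.

(** Division by [s], which gives 0 where [s] vanishes because [0^-1 = 0]. *)
Definition over_s (g : X -> R[i]) : X -> R[i] := fun x => (s x)^-1%:C * g x.

Lemma cmeasurable_over_s g : cmeasurable g -> cmeasurable (over_s g).
Proof.
apply: cmeasurableZ; rewrite (_ : (fun x => _) = fun x => powR (s x) (-1)).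
  exact: (measurableT_comp (measurable_powR _) ms).
by apply/funext => x; rewrite powR_inv1.
Qed.

Lemma density_over_sqr_le1 i x : r i x * (s x)^-1 ^+ 2 <= 1.
Proof.
have [sx|sx] := eqVneq (s x) 0; first by rewrite rs0// mul0r.
by rewrite exprVn ler_pdivrMr ?mul1r// exprn_gt0// lt0r sx s0.
Qed.

Lemma L2_wcomp_fun_over_s i g : L2 mu g ->
  L2 mu (wcomp_fun (phi i) (w i) (over_s g)) /\
  (norm2 mu (wcomp_fun (phi i) (w i) (over_s g)) <= norm2 mu g)%E.
Proof.
move=> g2; have [mg _] := g2; rewrite -[leRHS]mul1e.
apply: (@L2_wcomp_fun_le _ _ _ mu (phi i) (w i) (r i)
  (mphi i) (mw i) (rP i)) => //.
  exact: cmeasurable_over_s.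
move=> x; rewrite /over_s sqmodZ mulrA ler_wpM2r ?sqmod_ge0//.
exact: density_over_sqr_le1.
Qed.

Lemma polar_wcomp f : L2 mu f ->
  (forall i, L2 mu (wcomp_fun (phi i) (w i) f)) ->
  exists2 g, P f g & column U g (fun i => wcomp_fun (phi i) (w i) f).
Proof.
move=> f2 wf2.
have [_ _ _ /(_ f (fun i => wcomp_fun (phi i) (w i) f))[H _]] := polar.
by apply: H => i; split => //; exact: aeW.
Qed.

Let opU i : is_operator mu (U i).
Proof. by have [_ [H _ _ _] _ _] := polar. Qed.

(** [U] is determined by its kernel and by [U (s f) = T f]. Split [g] along [{s
    = 0}], [{s >= 1 / (n + 1)}] and the rest. The first part is in [ker T = ker
    U], the second is [s f] with [f = g / s] in the domain of [T], and the
    third tends to 0 in norm as [n] grows, while [U] and the right-hand side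
    are bounded operators. *)
Lemma polar_isometry_column g v : column U g v ->
  forall i, eqL2 mu (v i) (wcomp_fun (phi i) (w i) (over_s g)).
Proof.
move=> Ugv i.
have [g2 _] := operator_L2 (opU ord0) (Ugv ord0).
have [mg goo] := g2.
have [_ [_ _ [M UM] _] kerU _] := polar.
have mset (Q : set R) : measurable Q -> measurable (s @^-1` Q).
  by move=> mQ; rewrite -[X in measurable X]setTI; exact: ms.
pose Z := s @^-1` [set 0]; have mZ : measurable Z by exact: mset.
pose C (n : nat) := s @^-1` `[n.+1%:R^-1, +oo[.
have mC n : measurable (C n) by exact: mset.
pose E n := s @^-1` `]0, n.+1%:R^-1[.
have mE n : measurable (E n) by exact: mset.
(* the part of [g] that is left out lives where [s] is positive and small *)
have gE n x : g x - cut Z g x - cut (C n) g x = cut (E n) g x.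
  have inv0 : 0 < n.+1%:R^-1 :> R by rewrite invr_gt0 ltr0n.
  have memZ : (x \in Z) = (s x == 0).
    by apply/idP/idP; rewrite inE => /eqP.
  have memC : (x \in C n) = (n.+1%:R^-1 <= s x).
    by apply/idP/idP; rewrite inE /C/= in_itv/= andbT.
  have memE : (x \in E n) = (0 < s x < n.+1%:R^-1).
    by apply/idP/idP; rewrite inE /E/= in_itv.
  rewrite !cutE memZ memC memE.
  have [->|sx] := eqVneq (s x) 0.
    by rewrite ltxx /= leNgt inv0/= subr0 subrr.
  rewrite (lt0r (s x)) sx s0/= subr0.
  by case: (leP n.+1%:R^-1 (s x)); rewrite ?subrr ?subr0.
have UZ : column U (cut Z g) (fun _ _ => 0).
  suff : column_kernel U (cut Z g) by [].
  rewrite kerU => j; have Z2 : L2 mu (cut Z g) by exact: L2_cut.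
  split=> //; first exact: L2_0.
  have mZg : cmeasurable (cut Z g) by case: Z2.
  have [x|_ le0] := @L2_wcomp_fun_le _ _ _ mu (phi j) (w j) (r j)
    (mphi j) (mw j) (rP j)
    0 (cut Z g) g (lexx 0) mZg g2.
    rewrite mul0r cutE; case: ifPn => [|_]; last by rewrite sqmod0 mulr0.
    by rewrite inE => /rs0 ->; rewrite mul0r.
  rewrite mul0e in le0.
  have mwZ : cmeasurable (wcomp_fun (phi j) (w j) (cut Z g)).
    by exact: cmeasurable_wcomp_fun.
  have /(norm2_eq0 mu mwZ) : norm2 mu (wcomp_fun (phi j) (w j) (cut Z g)) = 0%E.
    by apply/eqP; rewrite eq_le le0 norm2_ge0.
  by apply: filterS => x <-.
pose fC n := over_s (cut (C n) g).
have UC n : column U (cut (C n) g) (fun j => wcomp_fun (phi j) (w j) (fC n)).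
  have C2 : L2 mu (cut (C n) g) by exact: L2_cut.
  have [mCg _] := C2.
  have fC2 : L2 mu (fC n).
    apply: (@L2_le _ _ _ _ (n.+1%:R ^+ 2) _ g) => //.
    - exact: cmeasurable_over_s.
    - apply: aeW => x; rewrite /fC /over_s cutE; case: ifPn => [|_].
        rewrite inE /C/= in_itv/= andbT => Cx.
        have sx : 0 < s x by rewrite (lt_le_trans _ Cx)// invr_gt0 ltr0n.
        rewrite sqmodZ ler_wpM2r ?sqmod_ge0// lerXn2r ?nnegrE ?invr_ge0//.
        by rewrite -[leRHS]invrK lef_pV2// posrE invr_gt0 ltr0n.
      by rewrite mulr0 sqmod0 mulr_ge0// ?sqmod_ge0// sqr_ge0.
  have [g' Pg' Ug'] := polar_wcomp fC2 (fun j => (L2_wcomp_fun_over_s j C2).1).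
  have [_ g'2 g'E] := (polar_modulusE _ _).1 Pg'.
  move=> j; have [_ mv] := operator_L2 (opU j) (Ug' j).
  apply: (operator_eqL2 (opU j) (Ug' j)) => //; [by case: mv| |exact: aeW].
  move: g'E; apply: filterS => x ->; rewrite /fC /over_s cutE.
  case: ifPn => [|_]; last by rewrite !mulr0.
  rewrite inE /C/= in_itv/= andbT => Cx.
  have sx : s x != 0 by rewrite gt_eqF// (lt_le_trans _ Cx)// invr_gt0 ltr0n.
  by rewrite mulrA -rmorphM/= divff// mul1r.
have [wg2 _] := L2_wcomp_fun_over_s i g2; have [mwg _] := wg2.
have [_ v2] := operator_L2 (opU i) (Ugv i); have [mv _] := v2.
have mdiff : cmeasurable
    (fun x => v i x - wcomp_fun (phi i) (w i) (over_s g) x).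
  exact: cmeasurableB.
suff : norm2 mu (fun x => v i x - wcomp_fun (phi i) (w i) (over_s g) x) = 0%E.
  move/(norm2_eq0 mu mdiff); apply: filterS => x /eqP.
  by rewrite subr_eq0 => /eqP.
have bound n : (norm2 mu
      (fun x => (v i x - wcomp_fun (phi i) (w i) (over_s g) x)%R) <=
    (2 * `|M| + 2)%:E * norm2 mu (cut (E n) g))%E.
  have E2 : L2 mu (cut (E n) g) by exact: L2_cut.
  have UE : column U (cut (E n) g)
      (fun j x => v j x - 0 - wcomp_fun (phi j) (w j) (fC n) x).
    move=> j; rewrite (_ : cut (E n) g = fun x => g x - cut Z g x - cut (C n) g x).
      exact: (operatorB (opU j) (operatorB (opU j) (Ugv j) (UZ j)) (UC n j)).
    by apply/funext => x; rewrite gE.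
  have nE : (norm2 mu
        (fun x => (v i x - 0 - wcomp_fun (phi i) (w i) (fC n) x)%R) <=
      `|M|%:E * norm2 mu (cut (E n) g))%E.
    apply: (@le_trans _ _ (M%:E * norm2 mu (cut (E n) g))%E).
      apply: le_trans (UM _ _ UE).
      rewrite [leRHS](bigD1 i)//= leeDl// sume_ge0// => j _.
      exact: norm2_ge0.
    by rewrite lee_wpmul2r ?norm2_ge0// lee_fin ler_norm.
  have [wE2 wEle] := L2_wcomp_fun_over_s i E2.
  have [mwE _] := wE2.
  have [_ [mUE _]] := operator_L2 (opU i) (UE i).
  rewrite (_ : (fun x => _) =
      fun x => (v i x - 0 - wcomp_fun (phi i) (w i) (fC n) x) +
      - wcomp_fun (phi i) (w i) (over_s (cut (E n) g)) x); last first.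
    apply/funext => x; rewrite subr0 /wcomp_fun /fC /over_s -gE.
    set y := phi i x.
    have -> : (s y)^-1%:C * (g y - cut Z g y - cut (C n) g y) =
        (s y)^-1%:C * g y - (s y)^-1%:C * cut (C n) g y.
      rewrite !mulrBr (_ : _ * cut Z g y = 0) ?subr0//.
      rewrite cutE; case: ifPn => [|_]; last by rewrite mulr0.
      by rewrite inE /Z/= => ->; rewrite invr0 mul0r.
    ring.
  apply: (le_trans (norm2D_le mu mUE (cmeasurableN mwE))).
  rewrite (_ : norm2 mu (fun x => - _) =
      norm2 mu (wcomp_fun (phi i) (w i) (over_s (cut (E n) g)))); last first.
    by apply: eq_integral => x _; rewrite sqmodN.
  apply: (@le_trans _ _ (2%:E * (`|M|%:E * norm2 mu (cut (E n) g)) +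
      2%:E * norm2 mu (cut (E n) g))%E).
    by apply: leeD; apply: lee_wpmul2l.
  by rewrite muleA -EFinM -ge0_muleDl ?lee_fin// -EFinD.
apply/eqP; rewrite eq_le norm2_ge0 andbT.
apply/lee_addgt0Pr => e e0; rewrite add0e.
have k0 : 0 < 2 * `|M| + 2 by rewrite ltr_wpDl// mulr_ge0.
have [] := @tail_integral _ _ _ mu (fun x => (sqmod (g x))%:E) E
  (e / (2 * `|M| + 2)) _ _ goo mE.
- exact: emeasurable_sqmod.
- by move=> x; rewrite lee_fin sqmod_ge0.
- apply: aeW => x; have [sx|sx] := eqVneq (s x) 0.
    by apply: nearW => n; rewrite /E/= sx in_itv/= ltxx.
  exists (Num.truncn (s x)^-1) => // n /= Hn.
  rewrite /E/= in_itv/= => /andP[sx0]; apply/negP; rewrite -leNgt.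
  rewrite -[leRHS]invrK lef_pV2 ?posrE ?invr_gt0 ?ltr0n//.
  apply: (le_trans (ltW (truncnS_gt _))).
  by rewrite ler_nat ltnS.
- by rewrite divr_gt0.
move=> n; rewrite -norm2_cut// => /ltW Hn.
apply: (le_trans (bound n)).
have := @lee_wpmul2l _ (2 * `|M| + 2)%:E; rewrite lee_fin => /(_ (ltW k0)).
move=> /(_ _ _ Hn)/le_trans; apply.
by rewrite -EFinM mulrC divfK// gt_eqF.
Qed.

Lemma polar_isometryE i g v : U i g v <->
  [/\ L2 mu g, L2 mu v & eqL2 mu v (wcomp_fun (phi i) (w i) (over_s g))].
Proof.
have [_ [_ domU _ _] _ _] := polar.
split=> [Uv|[g2 v2 vE]].
  have [g2 v2] := operator_L2 (opU i) Uv; split => //.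
  have [v' Uv'] := domU g g2.
  have := polar_isometry_column Uv' i.
  by move: (operator_fun (opU i) Uv (Uv' i)); apply: filterS2 => x -> ->.
have [v' Uv'] := domU g g2.
have [mg _] := g2; have [mv _] := v2.
apply: (operator_eqL2 (opU i) (Uv' i)) => //; first exact: aeW.
by move: vE (polar_isometry_column Uv' i); apply: filterS2 => x -> ->.
Qed.

End Polar.

(** * The mean weight *)

Section MeanWeight.
Local Open Scope complex_scope.
Context d (X : measurableType d) (R : realType).
Variable mu : {measure set X -> \bar R}.
Variables (phi : X -> X) (w : X -> R[i]) (H : X -> \bar R) (lambda : R).
Hypotheses (mphi : measurable_fun setT phi) (mw : cmeasurable w)
  (mH : measurable_fun setT H) (H0 : forall x, (0 <= H x)%E)
  (l01 : 0 < lambda < 1).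
Let s x := Num.sqrt (fine (H x)).

Let ms : measurable_fun setT s.
Proof. exact: measurable_sqrt_fine. Qed.

Let s0 x : 0 <= s x. Proof. exact: sqrtr_ge0. Qed.

(** [w_lambda = lambda w + (1 - lambda) eta w], and [eta w (u o phi)] is [s w
    ((u / s) o phi)], the weight [s w] applied to [u / s]. *)
Lemma wcomp_fun_mean_weight u x :
  wcomp_fun phi (mean_weight lambda phi w H) u x =
  lambda%:C * wcomp_fun phi w u x +
  (1 - lambda)%:C * wcomp_fun phi (sqrt_weight H w) (over_s s u) x.
Proof.
rewrite /wcomp_fun /mean_weight /Defs.eta /sqrt_weight /over_s -/(s x).
have [->|wx] := eqVneq (w x) 0; first by rewrite !mulr0 !mul0r !mulr0 addr0.
rewrite sqrtrM ?fine_ge0// sqrtrV ?fine_ge0// -/(s x) -/(s (phi x)).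
set a := s x; set b := (s (phi x))^-1.
rewrite (_ : a * b + lambda * (1 - a * b) =
  lambda + (1 - lambda) * (a * b)); last by ring.
by rewrite rmorphD/= !rmorphM/=; ring.
Qed.

Lemma cmeasurable_mean_weight : cmeasurable (mean_weight lambda phi w H).
Proof.
have c1 := cmeasurable_cst X (1 : R[i]).
have -> : mean_weight lambda phi w H = fun x =>
    lambda%:C * wcomp_fun phi w (fun=> 1) x +
    (1 - lambda)%:C * wcomp_fun phi (sqrt_weight H w) (over_s s (fun=> 1)) x.
  by apply/funext => x; rewrite -wcomp_fun_mean_weight /wcomp_fun mulr1.
apply: cmeasurableD; apply: cmeasurableM; try exact: cmeasurable_cst.
  exact: cmeasurable_wcomp_fun.
apply: cmeasurable_wcomp_fun => //; first exact: cmeasurable_sqrt_weight.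
exact: cmeasurable_over_s.
Qed.

Let mow := cmeasurable_mean_weight.

(** The two summands of the mean weight are nonnegative multiples of the same
    function [w (u o phi)], so they cannot cancel. *)
Lemma sqmod_mean_weight u x :
  sqmod (wcomp_fun phi w u x) <=
    lambda ^- 2 * sqmod (wcomp_fun phi (mean_weight lambda phi w H) u x) /\
  sqmod (wcomp_fun phi (sqrt_weight H w) (over_s s u) x) <=
    (1 - lambda) ^- 2 * sqmod (wcomp_fun phi (mean_weight lambda phi w H) u x).
Proof.
have /andP[l0 l1] := l01; have l1' : 0 < 1 - lambda by rewrite subr_gt0.
set z := wcomp_fun phi w u x; pose t := s x * (s (phi x))^-1.
have t0 : 0 <= t by rewrite mulr_ge0// invr_ge0.
have tE : wcomp_fun phi (sqrt_weight H w) (over_s s u) x = t%:C * z.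
  by rewrite /z /wcomp_fun /sqrt_weight /over_s -/(s x) /t rmorphM/=; ring.
rewrite wcomp_fun_mean_weight tE -/z.
have lt0 : 0 <= (1 - lambda) * t by rewrite mulr_ge0// ltW.
have llt0 : 0 <= lambda + (1 - lambda) * t by rewrite addr_ge0// ltW.
have l0' := ltW l0.
have -> : lambda%:C * z + (1 - lambda)%:C * (t%:C * z) =
    (lambda + (1 - lambda) * t)%:C * z.
  by rewrite [in RHS]rmorphD/= [in RHS]rmorphM/=; ring.
rewrite !sqmodZ.
split; rewrite mulrA.
  rewrite ler_peMl ?sqmod_ge0// -ler_pdivrMl ?invrK ?mulr1 ?invr_gt0 ?exprn_gt0//.
  by rewrite lerXn2r ?nnegrE// lerDl.
rewrite ler_wpM2r ?sqmod_ge0// mulrC ler_pdivlMr ?exprn_gt0// -exprMn mulrC.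
by rewrite lerXn2r ?nnegrE// lerDr ltW.
Qed.

Lemma L2_mean_weight u : L2 mu u ->
  L2 mu (wcomp_fun phi (mean_weight lambda phi w H) u) <->
  L2 mu (wcomp_fun phi w u) /\
  L2 mu (wcomp_fun phi (sqrt_weight H w) (over_s s u)).
Proof.
have /andP[l0 l1] := l01; have l1' : 0 < 1 - lambda by rewrite subr_gt0.
move=> [mu' _]; split=> [mw2|[w2 sw2]].
  split.
    apply: (@L2_le _ _ _ _ (lambda ^- 2) _ _ _ _ mw2).
    - by rewrite invr_ge0 sqr_ge0.
    - exact: cmeasurable_wcomp_fun.
    - by apply: aeW => x; have [] := sqmod_mean_weight u x.
  apply: (@L2_le _ _ _ _ ((1 - lambda) ^- 2) _ _ _ _ mw2).
  - by rewrite invr_ge0 sqr_ge0.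
  - apply: cmeasurable_wcomp_fun => //; first exact: cmeasurable_sqrt_weight.
    exact: cmeasurable_over_s.
  - by apply: aeW => x; have [] := sqmod_mean_weight u x.
rewrite (funext (wcomp_fun_mean_weight u)).
by apply: L2D; exact: L2Zl.
Qed.

Variables (h G : X -> \bar R).
Hypotheses (hP : is_RN mu phi w h) (GP : is_RN mu phi (sqrt_weight H w) G).

(** Comparable, up to constant factors, to the density of the measure that
    [phi] transports from the mean weight; the second summand is the part due
    to [eta]. *)
Definition mean_density x : \bar R := (h x + G x * ((s x) ^- 2)%:E)%E.

Lemma mean_density_ge0 x : (0 <= mean_density x)%E.
Proof.
have [_ h0 _] := hP; have [_ G0 _] := GP.
by rewrite adde_ge0// mule_ge0// lee_fin invr_ge0 sqr_ge0.
Qed.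

Lemma measurable_mean_density : measurable_fun setT mean_density.
Proof.
have [mh _ _] := hP; have [mG _ _] := GP.
apply: emeasurable_funD => //; apply: emeasurable_funM => //.
apply/measurable_EFinP; rewrite (_ : (fun x => _) = fun x => powR (s x ^+ 2) (-1)).
  apply: (measurableT_comp (measurable_powR _)); exact: measurable_funX.
by apply/funext => x; rewrite powR_inv1 ?sqr_ge0.
Qed.

Lemma dom_mean_weight :
  dom (wcomp mu phi (mean_weight lambda phi w H)) =
  [set u | L2 mu u /\ (\int[mu]_x (mean_density x * (sqmod (u x))%:E) < +oo)%E].
Proof.
have [mh h0 _] := hP; have [mG G0 _] := GP.
have msw : cmeasurable (sqrt_weight H w) by exact: cmeasurable_sqrt_weight.
have intE u : cmeasurable u -> (\int[mu]_x (mean_density x * (sqmod (u x))%:E) =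
    norm2 mu (wcomp_fun phi w u) +
    norm2 mu (wcomp_fun phi (sqrt_weight H w) (over_s s u)))%E.
  move=> mu'; have mou : cmeasurable (over_s s u) by exact: cmeasurable_over_s.
  rewrite (norm2_wcomp_fun mphi mw hP)// (norm2_wcomp_fun mphi msw GP)//.
  rewrite -ge0_integralD//.
  - apply: eq_integral => x _; rewrite /mean_density ge0_muleDl//.
      by rewrite /over_s sqmodZ exprVn EFinM muleA.
    by rewrite mule_ge0// lee_fin invr_ge0 sqr_ge0.
  - by move=> x _; rewrite mule_ge0// lee_fin sqmod_ge0.
  - by apply: emeasurable_funM => //; exact: emeasurable_sqmod.
  - by move=> x _; rewrite mule_ge0// lee_fin sqmod_ge0.
  - by apply: emeasurable_funM => //; exact: emeasurable_sqmod.
apply/seteqP; split => u.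
  move=> [v /wcompE[u2 v2 vu]]; split => //.
  have [mu' _] := u2.
  have wu2 : L2 mu (wcomp_fun phi (mean_weight lambda phi w H) u).
    apply: eqL2_L2 v2 _ _; first exact: cmeasurable_wcomp_fun.
    by move: vu; apply: filterS => x ->.
  have [[_ a] [_ b]] := (L2_mean_weight u2).1 wu2.
  by rewrite intE// lte_add_pinfty.
move=> [u2]; have [mu' _] := u2; rewrite intE// => fin.
have wu2 : L2 mu (wcomp_fun phi (mean_weight lambda phi w H) u).
  apply/(L2_mean_weight u2); split; split.
  - exact: cmeasurable_wcomp_fun.
  - by apply: le_lt_trans fin; rewrite leeDl// norm2_ge0.
  - by apply: cmeasurable_wcomp_fun => //; exact: cmeasurable_over_s.
  - by apply: le_lt_trans fin; rewrite leeDr// norm2_ge0.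
exists (wcomp_fun phi (mean_weight lambda phi w H) u); split => //.
exact: aeW.
Qed.

Lemma mean_density_finite : {ae mu, forall x, (h x < +oo)%E} ->
  {ae mu, forall x, (H x < +oo)%E} ->
  {ae mu, forall x, H x = 0%E -> G x = 0%E} ->
  {ae mu, forall x, (mean_density x < +oo)%E} <->
  {ae mu, forall x, (G x < +oo)%E}.
Proof.
have [mh h0 _] := hP; have [mG G0 _] := GP.
move=> hoo Hoo HG; split.
- move: Hoo HG; apply: filterS3 => x Hx HGx.
  have [Hx0|Hx0] := eqVneq (H x) 0%E; first by rewrite HGx.
  have s2 : s x ^+ 2 = fine (H x) by rewrite sqr_sqrtr// fine_ge0.
  have sx : 0 < s x ^- 2.
    by rewrite invr_gt0 s2 fine_gt0// Hx andbT lt0e Hx0 H0.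
  rewrite /mean_density !ltey => /eqP mdx; apply/eqP => Gx; apply: mdx.
  by rewrite Gx gt0_mulye ?lte_fin// addey// gt_eqF// (lt_le_trans _ (h0 x)).
- move: hoo; apply: filterS2 => x hx Gx; apply: lte_add_pinfty => //.
  rewrite muleC; apply: lte_mul_pinfty => //.
  by rewrite lee_fin invr_ge0 sqr_ge0.
Qed.

End MeanWeight.

(** * The spherical mean transform *)

Section MeanTransform.
Local Open Scope complex_scope.
Context d (X : measurableType d) (R : realType).
Variable mu : {measure set X -> \bar R}.
Variables (phi : 'I_2 -> X -> X) (w : 'I_2 -> X -> R[i]) (r : 'I_2 -> X -> R).
Variables (H : X -> \bar R) (lambda : R).
Hypotheses (mphi : forall i, measurable_fun setT (phi i))
  (mw : forall i, cmeasurable (w i))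
  (rP : forall i, is_RN mu (phi i) (w i) (EFin \o r i))
  (mH : measurable_fun setT H) (H0 : forall x, (0 <= H x)%E)
  (HE : forall x, fine (H x) = \sum_(i < 2) r i x)
  (l01 : 0 < lambda < 1).
Variables (U : 'I_2 -> operator X R) (P : operator X R).
Hypothesis polar :
  is_polar_decomposition mu (fun i => wcomp mu (phi i) (w i)) U P.

(** The identity is between columns, not between components: [U_i |T|] requires
    [f] to be in the domain of [|T|], hence of both weighted composition
    operators. For a column this is automatic, since membership in the domain
    for the mean weight [i] forces [w_i (f o phi_i)] to be square integrable,
    for each [i]. *)
Theorem spherical_mean_transformE f g :
  column (spherical_mean_transform mu lambda U P) f g <->
  column (fun i => wcomp mu (phi i) (mean_weight lambda (phi i) (w i) H)) f g.
Proof.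
pose s x := Num.sqrt (fine (H x)).
have s0 x : 0 <= s x by exact: sqrtr_ge0.
have sE x : s x ^+ 2 = \sum_(i < 2) r i x.
  by rewrite sqr_sqrtr ?HE// -HE fine_ge0.
have ms : measurable_fun setT s by exact: measurable_sqrt_fine.
have PE := polar_modulusE mphi mw rP ms s0 sE polar.
have UE := polar_isometryE mphi mw rP ms s0 sE polar.
have r0 i x : 0 <= r i x by case: (rP i) => _ /(_ x); rewrite lee_fin.
have sw i u x : (s x)%:C * wcomp_fun (phi i) (w i) u x =
    wcomp_fun (phi i) (sqrt_weight H (w i)) u x.
  by rewrite /wcomp_fun /sqrt_weight mulrA.
have s_neq0 i : {ae mu, forall x, w i x != 0 -> s (phi i x) != 0}.
  have mZ : measurable (s @^-1` [set 0]).
    by rewrite -[X in measurable X]setTI; exact: ms.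
  have : {ae mu, forall x, (s @^-1` [set 0]) x -> (EFin \o r i) x = 0%E}.
    apply: aeW => x /= sx; congr EFin; apply/eqP; rewrite eq_le r0 andbT.
    rewrite (_ : 0 = s x ^+ 2); last by rewrite sx expr0n.
    by rewrite sE (bigD1 i)//= lerDl sumr_ge0.
  move/(RN_preimage_null (mphi i) (mw i) (rP i) mZ); rewrite ae_wmeasureP//.
  by apply: filterS => x sx /sx /eqP.
split=> Sfg.
- move=> i; have [g1 [g2 [[k1 Pfk1 Uk1] [k2 Uk2 Pk2] gi2 gE]]] := Sfg i.
  have [f2 k12 k1E] := (PE _ _).1 Pfk1.
  have [_ _ g1E] := (UE _ _ _).1 Uk1.
  have [_ _ k2E] := (UE _ _ _).1 Uk2.
  have [_ _ g2E] := (PE _ _).1 Pk2.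
  split => //.
  have g1E' : eqL2 mu g1 (wcomp_fun (phi i) (w i) f).
    move: g1E (ae_comp (mphi i) (mw i) (rP i) k1E) (s_neq0 i).
    apply: filterS3 => x -> k1x sx; rewrite /wcomp_fun /over_s.
    have [->|wx] := eqVneq (w i x) 0; first by rewrite !mul0r.
    by rewrite k1x// [_ * (_ * f _)]mulrA -rmorphM/= mulVf ?sx// mul1r.
  have g2E' : eqL2 mu g2 (wcomp_fun (phi i) (sqrt_weight H (w i)) (over_s s f)).
    by move: g2E k2E; apply: filterS2 => x -> ->; rewrite sw.
  move: gE g1E' g2E'; apply: filterS3 => x -> -> ->.
  by rewrite -[RHS]/(wcomp_fun _ _ f x) wcomp_fun_mean_weight.
- have f2 : L2 mu f by case: (Sfg ord0).
  have [mf _] := f2.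
  have gE i : eqL2 mu (g i)
      (wcomp_fun (phi i) (mean_weight lambda (phi i) (w i) H) f).
    by case: (Sfg i).
  have both i : L2 mu (wcomp_fun (phi i) (w i) f) /\
      L2 mu (wcomp_fun (phi i) (sqrt_weight H (w i)) (over_s s f)).
    apply/(L2_mean_weight (mphi i) (mw i) mH H0 l01 f2).
    have [_ gi2 _] := Sfg i; apply: eqL2_L2 gi2 _ _.
      apply: cmeasurable_wcomp_fun => //; exact: cmeasurable_mean_weight.
    by move: (gE i); apply: filterS => x ->.
  have [k1 Pfk1 Uk1] := polar_wcomp polar f2 (fun i => (both i).1).
  move=> i; exists (wcomp_fun (phi i) (w i) f).
  exists (wcomp_fun (phi i) (sqrt_weight H (w i)) (over_s s f)); split.
  + by exists k1.
  + have [wf2 _] := L2_wcomp_fun_over_s mphi mw rP ms s0 sE i f2.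
    exists (wcomp_fun (phi i) (w i) (over_s s f)).
      by apply/UE; split => //; exact: aeW.
    apply/PE; split => //; first by case: (both i).
    by apply: aeW => x; rewrite sw.
  + by case: (Sfg i).
  + by move: (gE i); apply: filterS => x ->; rewrite wcomp_fun_mean_weight.
Qed.

End MeanTransform.

(** * The equivalences *)

Section Assembly.
Context d (X : measurableType d) (R : realType).
Variable mu : {sigma_finite_measure set X -> \bar R}.
Variables (phi : X -> X) (w : X -> R[i]) (h : X -> \bar R).
Hypotheses (mphi : measurable_fun setT phi) (mw : cmeasurable w)
  (hP : is_RN mu phi w h).

Lemma densely_defined_wcompP : densely_defined mu (wcomp mu phi w) <->
  {ae mu, forall x, (h x < +oo)%E}.
Proof.
have [mh h0 _] := hP.
by rewrite /densely_defined (dom_wcomp mphi mw hP) dense_weighted_L2P.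
Qed.

Lemma is_RN_ae h' : measurable_fun setT h' -> (forall x, (0 <= h' x)%E) ->
  {ae mu, forall x, h x = h' x} -> is_RN mu phi w h'.
Proof.
move=> mh' h'0 hh'; have [mh h0 hE] := hP; split => // D mD; rewrite hE//.
apply: ae_eq_integral => //; try exact: measurable_funTS.
by move: hh'; apply: filterS.
Qed.

End Assembly.

Theorem corollary24 (d : measure_display) (X : measurableType d) (R : realType)
  (mu : {sigma_finite_measure set X -> \bar R})
  (phi : 'I_2 -> X -> X) (omega : 'I_2 -> X -> R[i]) (lambda : R)
  (mphi : forall i, measurable_fun setT (phi i))
  (momega : forall i, cmeasurable (omega i))
  (ac : forall i, pushforward (wmeasure mu (omega i)) (phi i) `<< mu)
  (dd : forall i, densely_defined mu (wcomp mu (phi i) (omega i)))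
  (lambda01 : 0 < lambda < 1)
  (h : 'I_2 -> X -> \bar R)
  (hP : forall i, is_RN mu (phi i) (omega i) (h i))
  (H : X -> \bar R)
  (HE : forall x, H x = (\sum_(i < 2) h i x)%E)
  (U : 'I_2 -> operator X R) (P : operator X R)
  (polar : is_polar_decomposition mu
             (fun i => wcomp mu (phi i) (omega i)) U P)
  (EH FH : 'I_2 -> X -> \bar R)
  (EHP : forall i, is_condexp mu (phi i) (omega i) H (EH i))
  (FHP : forall i,
     is_condexp_pullback mu (phi i) (omega i) (h i) (EH i) (FH i))
  (Eh Fh : 'I_2 -> 'I_2 -> X -> \bar R)
  (EhP : forall i j, is_condexp mu (phi i) (omega i) (h j) (Eh i j))
  (FhP : forall i j,
     is_condexp_pullback mu (phi i) (omega i) (h i) (Eh i j) (Fh i j)) :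
  (forall f g,
     column (spherical_mean_transform mu lambda U P) f g <->
     column (fun i => wcomp mu (phi i)
                        (mean_weight lambda (phi i) (omega i) H)) f g) /\
  [<-> densely_defined mu (column (spherical_mean_transform mu lambda U P));
       forall i, densely_defined mu
         (wcomp mu (phi i) (mean_weight lambda (phi i) (omega i) H));
       forall i, {ae mu, forall x, (FH i x < +oo)%E};
       forall i j, {ae mu, forall x, (Fh i j x < +oo)%E};
       forall i j, {ae mu, forall x, omega i x != 0 -> (Eh i j x < +oo)%E};
       forall i, {ae mu, forall x, omega i x != 0 -> (EH i x < +oo)%E};
       forall i j, {ae wmeasure mu (omega i), forall x, (Eh i j x < +oo)%E};
       forall i, {ae wmeasure mu (omega i), forall x, (EH i x < +oo)%E};
       forall i, sigma_finite setT
         (pushforward (wmeasure mu (sqrt_weight H (omega i))) (phi i));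
       forall i, sigma_finite_on_preimage (phi i)
         (wmeasure mu (sqrt_weight H (omega i)));
       forall i j, sigma_finite setT
         (pushforward (wmeasure mu (sqrt_weight (h j) (omega i))) (phi i));
       forall i j, sigma_finite_on_preimage (phi i)
         (wmeasure mu (sqrt_weight (h j) (omega i)))].
Proof.
have mh i : measurable_fun setT (h i) by case: (hP i).
have h0 i x : (0 <= h i x)%E by case: (hP i).
have H2 x : H x = (h ord0 x + h (lift ord0 ord0) x)%E.
  by rewrite HE !big_ord_recl big_ord0 adde0.
(* the two elements of ['I_2], in the form produced by [big_ord_recl] *)
have two (Q : 'I_2 -> Prop) : Q ord0 -> Q (lift ord0 ord0) -> forall i, Q i.
  by move=> Q0 Q1 i; case: (unliftP ord0 i) => [j|] -> //; rewrite (ord1 j).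
have mH : measurable_fun setT H.
  by rewrite (funext H2); exact: emeasurable_funD.
have H0 x : (0 <= H x)%E by rewrite H2 adde_ge0.
have hoo i : {ae mu, forall x, (h i x < +oo)%E}.
  exact/(densely_defined_wcompP (mphi i) (momega i) (hP i)).
have Hoo : {ae mu, forall x, (H x < +oo)%E}.
  move: (hoo ord0) (hoo (lift ord0 ord0)); apply: filterS2 => x a b.
  by rewrite H2 lte_add_pinfty.
have hH i x : (h i x <= H x)%E.
  by move: i; apply: two; rewrite H2 ?leeDl ?leeDr.
(* Versions of the densities that are finite everywhere. As [fine] sends +oo to
   0, setting them to 0 where [H = +oo] makes their sum equal to [fine H] at
   every point, and the mean weight is unaffected. *)
pose r i x : R := if (H x < +oo)%E then fine (h i x) else 0.
have rP i : is_RN mu (phi i) (omega i) (EFin \o r i).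
  apply: (is_RN_ae (hP i)).
  - apply/measurable_EFinP; apply: measurable_fun_ifT => //.
      exact: measurable_fun_lte.
    exact: (measurableT_comp (fine_measurable measurableT)).
  - by move=> x; rewrite lee_fin /r; case: ifP => // _; rewrite fine_ge0.
  - move: Hoo; apply: filterS => x Hx; rewrite /r /= Hx fineK//.
    by rewrite ge0_fin_numE// (le_lt_trans (hH i x)).
have HrE x : fine (H x) = \sum_(i < 2) r i x.
  rewrite /r !big_ord_recl big_ord0 addr0.
  case: ifPn => [Hx|]; last by rewrite -leNgt leye_eq => /eqP ->; rewrite addr0.
  rewrite H2 fineD// ge0_fin_numE//; exact: le_lt_trans (hH _ x) Hx.
have SE := spherical_mean_transformE mphi momega rP mH H0 HrE lambda01 polar.
split=> //.
pose GH i x := (h i x * maxe (FH i x) 0)%E.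
pose Gh i j x := (h i x * maxe (Fh i j x) 0)%E.
have GHP i : is_RN mu (phi i) (sqrt_weight H (omega i)) (GH i).
  exact: (condexp_RN (mphi i) (momega i) (hP i) mH H0 Hoo (EHP i) (FHP i)).
have GhP i j : is_RN mu (phi i) (sqrt_weight (h j) (omega i)) (Gh i j).
  exact: (condexp_RN (mphi i) (momega i) (hP i) (mh j) (h0 j) (hoo j)
    (EhP i j) (FhP i j)).
have GH_FH i := condexp_density_finite (hP i) (hoo i) (FHP i).
have Gh_Fh i j := condexp_density_finite (hP i) (hoo i) (FhP i j).
pose kappa i := mean_density H (h i) (GH i).
have kappaE i : {ae mu, forall x, (kappa i x < +oo)%E} <->
    {ae mu, forall x, (FH i x < +oo)%E}.
  rewrite -(GH_FH i); apply: (mean_density_finite H0 (hP i) (GHP i)) => //.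
  apply: aeW => x Hx; rewrite /GH (_ : h i x = 0%E) ?mul0e//.
  by apply/eqP; rewrite eq_le h0 andbT -Hx hH.
have mk i : measurable_fun setT (kappa i) :=
  measurable_mean_density mH (hP i) (GHP i).
have k0 i x : (0 <= kappa i x)%E by exact: (mean_density_ge0 (hP i) (GHP i)).
have domE i : dom (wcomp mu (phi i) (mean_weight lambda (phi i) (omega i) H)) =
    [set u | L2 mu u /\ (\int[mu]_x (kappa i x * (sqmod (u x))%:E) < +oo)%E].
  exact: (dom_mean_weight (mphi i) (momega i) mH H0 lambda01 (hP i) (GHP i)).
have ii_iii i : densely_defined mu
      (wcomp mu (phi i) (mean_weight lambda (phi i) (omega i) H)) <->
    {ae mu, forall x, (FH i x < +oo)%E}.
  by rewrite -kappaE /densely_defined domE dense_weighted_L2P.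
(* the domain of the column is the intersection of the two domains, which is the
   weighted domain of [kappa_0 + kappa_1] *)
have i_iii :
    densely_defined mu (column (spherical_mean_transform mu lambda U P)) <->
    forall i, {ae mu, forall x, (FH i x < +oo)%E}.
  pose k2 x := (kappa ord0 x + kappa (lift ord0 ord0) x)%E.
  have domk2 : dom (column (spherical_mean_transform mu lambda U P)) =
      [set u | L2 mu u /\ (\int[mu]_x (k2 x * (sqmod (u x))%:E) < +oo)%E].
    have intE u : cmeasurable u -> (\int[mu]_x (k2 x * (sqmod (u x))%:E) =
        \int[mu]_x (kappa ord0 x * (sqmod (u x))%:E) +
        \int[mu]_x (kappa (lift ord0 ord0) x * (sqmod (u x))%:E))%E.
      move=> mu'; rewrite -ge0_integralD//.
      - by apply: eq_integral => x _; rewrite ge0_muleDl.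
      - by move=> x _; rewrite mule_ge0// lee_fin sqmod_ge0.
      - by apply: emeasurable_funM => //; exact: emeasurable_sqmod.
      - by move=> x _; rewrite mule_ge0// lee_fin sqmod_ge0.
      - by apply: emeasurable_funM => //; exact: emeasurable_sqmod.
    have domi i u :
        dom (wcomp mu (phi i) (mean_weight lambda (phi i) (omega i) H)) u <->
        L2 mu u /\ (\int[mu]_x (kappa i x * (sqmod (u x))%:E) < +oo)%E.
      by rewrite domE.
    apply/seteqP; split => u.
      move=> [g /SE Sg]; have Di i := (domi i u).1 (ex_intro _ _ (Sg i)).
      have [[mu' _] _] := Di ord0.
      split; first by case: (Di ord0).
      rewrite intE// lte_add_pinfty//; first by case: (Di ord0).
      by case: (Di (lift ord0 ord0)).
    move=> [u2]; have [mu' _] := u2; rewrite intE// => fin.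
    have int0 i : (0 <= \int[mu]_x (kappa i x * (sqmod (u x))%:E))%E.
      by apply: integral_ge0 => x _; rewrite mule_ge0// lee_fin sqmod_ge0.
    have Di i :
        dom (wcomp mu (phi i) (mean_weight lambda (phi i) (omega i) H)) u.
      apply/domi; split => //; move: i; apply: two.
        by apply: le_lt_trans fin; rewrite leeDl.
      by apply: le_lt_trans fin; rewrite leeDr.
    have [g gP] := choice Di.
    by exists g; apply/SE.
  have mk2 : measurable_fun setT k2 by exact: emeasurable_funD.
  have k20 x : (0 <= k2 x)%E by rewrite adde_ge0.
  rewrite /densely_defined domk2 dense_weighted_L2P//; split=> [k2oo i|Foo].
    apply/kappaE; move: k2oo; apply: filterS => x; apply: le_lt_trans.
    by move: i; apply: two; rewrite ?leeDl ?leeDr.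
  move: ((kappaE ord0).2 (Foo ord0)).
  move: ((kappaE (lift ord0 ord0)).2 (Foo (lift ord0 ord0))).
  by apply: filterS2 => x a b; rewrite /k2 lte_add_pinfty.
have iii_ix i := sigma_finite_condexpP
  (mphi i) (momega i) (hP i) (hoo i) mH H0 Hoo
  (EHP i) (FHP i).
have iv_xi i j := sigma_finite_condexpP
  (mphi i) (momega i) (hP i) (hoo i) (mh j)
  (h0 j) (hoo j) (EhP i j) (FhP i j).
have iii_viii i := condexp_pullback_finite (mphi i) (momega i) (hP i) (FHP i).
have iv_vii i j := condexp_pullback_finite (mphi i) (momega i) (hP i) (FhP i j).
have wm0 f : wmeasure mu f set0 = 0%E by exact: integral_set0.
(* [H = h_0 + h_1], so the densities of the measures transported from the [h_j]
   add up to a density of the one transported from [H] *)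
have iii_iv i : {ae mu, forall x, (FH i x < +oo)%E} <->
    forall j, {ae mu, forall x, (Fh i j x < +oo)%E}.
  pose G x := (Gh i ord0 x + Gh i (lift ord0 ord0) x)%E.
  have Gh0 j x : (0 <= Gh i j x)%E by case: (GhP i j).
  have mGh j : measurable_fun setT (Gh i j) by case: (GhP i j).
  have GP : is_RN mu (phi i) (sqrt_weight H (omega i)) G.
    split=> [|x|D mD].
    - exact: emeasurable_funD.
    - by rewrite adde_ge0.
    have mpD : measurable (phi i @^-1` D).
      by rewrite -[X in measurable X]setTI; exact: mphi.
    have GhE j : (\int[mu]_(x in D) Gh i j x =
        \int[mu]_(x in phi i @^-1` D) ((sqmod (omega i x))%:E * h j x))%E.
      have [_ _ <-//] := GhP i j.
      by rewrite wmeasure_sqrt_weight// integral_wmeasure_in.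
    rewrite wmeasure_sqrt_weight// integral_wmeasure_in//.
    have mwh j : measurable_fun (phi i @^-1` D)
        (fun x => (sqmod (omega i x))%:E * h j x)%E.
      apply: measurable_funTS; apply: emeasurable_funM => //.
      exact: emeasurable_sqmod.
    have wh0 j x : (0 <= (sqmod (omega i x))%:E * h j x)%E.
      by rewrite mule_ge0// lee_fin sqmod_ge0.
    rewrite [RHS]ge0_integralD//; [|exact: measurable_funTS|exact: measurable_funTS].
    rewrite !GhE -ge0_integralD//.
    by apply: eq_integral => x _; rewrite H2 ge0_muleDr.
  rewrite -(iii_ix i) (RN_sigma_finiteP GP); split=> [Goo j|Foo].
    apply/Gh_Fh; move: Goo; apply: filterS => x; apply: le_lt_trans.
    by move: j; apply: two; rewrite ?leeDl ?leeDr.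
  move: ((Gh_Fh i ord0).2 (Foo ord0)).
  move: ((Gh_Fh i (lift ord0 ord0)).2 (Foo (lift ord0 ord0))).
  by apply: filterS2 => x a b; rewrite /G lte_add_pinfty.
have v_vii i j := ae_wmeasureP mu (fun x => (Eh i j x < +oo)%E) (momega i).
have vi_viii i := ae_wmeasureP mu (fun x => (EH i x < +oo)%E) (momega i).
tfae.
- by move=> /i_iii Foo i; apply/ii_iii.
- by move=> D i; apply/ii_iii.
- by move=> Foo i; apply/iii_iv.
- by move=> Foo i j; apply/v_vii/iv_vii.
- move=> Eoo i; apply/vi_viii/iii_viii/iii_iv => j.
  exact/iv_vii/v_vii.
- move=> Eoo i; have /iii_iv Foo : {ae mu, forall x, (FH i x < +oo)%E}.
    exact/iii_viii/vi_viii.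
  by move=> j; apply/iv_vii.
- by move=> Eoo i; apply/iii_viii/iii_iv => j; apply/iv_vii.
- by move=> Eoo i; apply/iii_ix/iii_viii.
- by move=> sf i; apply/sigma_finite_preimageP.
- move=> sf i; have /iii_ix/iii_iv Foo : sigma_finite setT
      (pushforward (wmeasure mu (sqrt_weight H (omega i))) (phi i)).
    exact/sigma_finite_preimageP.
  by move=> j; apply/iv_xi.
- by move=> sf i j; apply/sigma_finite_preimageP.
- move=> sf; apply/i_iii => i; apply/iii_iv => j; apply/iv_xi.
  exact/sigma_finite_preimageP.
Qed.
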